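(* Let $G$ be a graph, let $n \ge 0$ be an integer, and suppose that $G$ is $n$-apex with $U \subset V(G)$ such that $|U| \leq n$ and $G-U$ is planar. If $G'$ is obtained from $G$ by a $\mathrm{Y}\nabla$ move at a vertex $v \notin U$, then $G'$ is also $n$-apex.
   Context: All graphs are finite. A graph is $n$-apex if deleting $n$ or fewer of its vertices can result in a planar graph. For $W \subset V(G)$, $G-W$ denotes the induced subgraph on $V(G)\setminus W$. A $\nabla\mathrm{Y}$ move on a graph deletes the three edges of a triangle $abc$ and then adds a new vertex $v$ together with the edges $av$, $bv$, $cv$. The reverse operation is a $\mathrm{Y}\nabla$ move at $v$: a degree-three vertex $v$ with neighbors $a,b,c$ is deleted (with its three incident edges) and the edges $ab$, $ac$, $bc$ are added. *)

(* Defs.v *)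
From HB Require Import structures.
From mathcomp Require Import all_boot all_order all_algebra.
From mathcomp Require Import all_classical all_reals all_analysis.
Import Order.TTheory GRing.Theory Num.Theory.
Import numFieldNormedType.Exports.

Set Implicit Arguments.
Unset Strict Implicit.
Unset Printing Implicit Defensive.

Local Open Scope classical_set_scope.
Local Open Scope ring_scope.

Record sgraph := SGraph {
  vertex :> finType;
  adj : rel vertex;
  adj_sym : symmetric adj;
  adj_irrefl : irreflexive adj }.

Definition neighbors (G : sgraph) (v : G) : {set G} := [set x : G | adj v x]%SET.

Section Induced.
Variables (G : sgraph) (W : {set G}).

Definition del_adj : rel {x : G | x \notin W} :=
  fun x y => adj (val x) (val y).

Lemma del_adj_sym : symmetric del_adj.
Proof. by move=> x y; exact: adj_sym. Qed.

Lemma del_adj_irrefl : irreflexive del_adj.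
Proof. by move=> x; exact: adj_irrefl. Qed.

(* The graph G - W. *)
Definition del_vertices : sgraph := SGraph del_adj_sym del_adj_irrefl.

End Induced.

Section AddEdge.
Variables (G : sgraph) (a b : G).

(* The guard [x != y] only matters when [a = b], where nothing is added. *)
Definition add_edge_adj : rel G :=
  fun x y => adj x y || [&& x != y, x \in [set a; b]%SET & y \in [set a; b]%SET].

Lemma add_edge_adj_sym : symmetric add_edge_adj.
Proof. by move=> x y; rewrite /add_edge_adj adj_sym eq_sym [(x \in _) && _]andbC. Qed.

Lemma add_edge_adj_irrefl : irreflexive add_edge_adj.
Proof. by move=> x; rewrite /add_edge_adj adj_irrefl eqxx. Qed.

(* Graphs are simple: adding an edge that is already present does nothing. *)
Definition add_edge : sgraph := SGraph add_edge_adj_sym add_edge_adj_irrefl.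

End AddEdge.

Definition isomorphic (G H : sgraph) : Prop :=
  exists f : G -> H, bijective f /\ forall x y, adj (f x) (f y) = adj x y.

(* [a], [b], [c] range over the vertices of G - v, so they differ from [v];
   the cardinality condition says that [v] has degree three and makes
   [a], [b], [c] pairwise distinct. *)
Definition Ydelta_move (G : sgraph) (v : G) (G' : sgraph) : Prop :=
  exists a b c : del_vertices [set v]%SET,
    [/\ #|neighbors v| = 3%N,
        neighbors v = [set val a; val b; val c]%SET &
        isomorphic
          (@add_edge (@add_edge (@add_edge (del_vertices [set v]%SET) a b) a c) b c)
          G'].

Definition is_arc (R : realType) (p q : R * R) (A : set (R * R)) : Prop :=
  exists g : R -> R * R,
    [/\ {within `[0, 1], continuous g}, {in `[0, 1] &, injective g},
        g 0 = p, g 1 = q & g @` `[0, 1] = A].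

(* [pos x] is the point representing the vertex [x] and [arc x y] the arc
   representing the edge xy; [arc] is irrelevant on nonadjacent pairs. *)
Definition plane_drawing (R : realType) (G : sgraph)
    (pos : G -> R * R) (arc : G -> G -> set (R * R)) : Prop :=
  let inner x y := arc x y `\` [set pos x; pos y] in
  [/\ injective pos,
      forall x y, adj x y -> arc x y = arc y x /\ is_arc (pos x) (pos y) (arc x y),
      forall x y z, adj x y -> ~ inner x y (pos z) &
      forall x y z w, adj x y -> adj z w ->
        [set x; y]%SET != [set z; w]%SET -> inner x y `&` arc z w = set0].

Definition planar (R : realType) (G : sgraph) : Prop :=
  exists pos arc, @plane_drawing R G pos arc.

Definition apex (R : realType) (n : nat) (G : sgraph) : Prop :=
  exists U : {set G}, (#|U| <= n)%N /\ planar R (del_vertices U).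

(* Main.v *)
Require Import Defs.
From HB Require Import structures.
From mathcomp Require Import all_boot all_order all_algebra.
From mathcomp Require Import all_classical all_reals all_analysis.
From mathcomp Require Import ring lra.
Import Order.TTheory GRing.Theory Num.Theory.
Import numFieldNormedType.Exports.
Set Implicit Arguments.
Unset Strict Implicit.
Unset Printing Implicit Defensive.
Local Open Scope classical_set_scope.
Local Open Scope ring_scope.

(** The move at [v] replaces the star formed by [v] and its three edges by a
    triangle on the neighbours [a], [b], [c] of [v]. As [v] is not in [U], a drawing
    of [G - U] contains the part of this star outside [U], and the same set [U],
    seen in [G'], works: [G' - U] is obtained from [G - U] by deleting [v] and
    joining its at most three neighbours to each other
    ([planar_nbr_clique]). So the point is that the missing edges can be drawn
    along the star. With at most two neighbours outside [U] the path through [v]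
    does it. With three, each arm of the star has to be followed by two of the new
    edges, one on each side, although the arms are mere continuous arcs, which
    have no evident sides. This is done without the Schoenflies theorem, in three
    steps.

    Straightening ([straighten]). In small disjoint round discs around the
    vertices, the beginning of every edge up to its last visit to the disc is
    replaced by a radius. Afterwards each edge leaves its ends along a straight
    segment in an open cone which is free of the rest of the drawing ([access]).

    Truncation ([star_triangle]). The arms are cut off at a small circle around
    [v], and their ends are joined by chords. This gives a triangle attached to
    [a], [b], [c] by three arms, and it remains to contract these arms.

    Contraction ([contract]). Let [w] have the three neighbours [x], [y], [z]; the
    edge [wx] is contracted to give two edges [xy] and [xz]. An injective
    continuous map of the plane which fixes the rest of the drawing moves [w]
    along the arm to a point of the straight segment at [x] ([drag]). It takes
    the arms to [y] and [z] along, so these follow the arm to [x] and no parallel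
    curves have to be constructed. The first point [r] of the segment, seen from
    [x], on the moved arms is a branch point joined to [x] by a clear segment in the
    free cone. Turning this segment slightly about [x], to one side or the other,
    makes it end on one of the two arms just beside [r] without meeting the other
    arm ([clear_turn_total]), and the two segments lead to the two new edges
    ([contract_clear]). *)

(** * Arcs *)

Section Arcs.
Variable R : realType.
Implicit Types (p q r : R * R) (A B C : set (R * R)) (g h : R -> R * R).

(** Composing with [clamp] extends a parametrization from the unit interval to a
    continuous function on the whole line; gluing and reparametrizing paths then
    needs no relative topology. *)
Definition clamp (t : R) : R := (`|t| - `|t - 1| + 1) / 2.

Lemma clamp_continuous : continuous clamp.
Proof.
move=> t; apply: cvgMr_tmp; apply: cvgD; last exact: cvg_cst.
apply: cvgB; first by apply: cvg_norm; exact: cvg_id.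
by apply: cvg_norm; apply: cvgB; [exact: cvg_id | exact: cvg_cst].
Qed.

Lemma clamp_id t : 0 <= t <= 1 -> clamp t = t.
Proof.
case/andP => t0 t1; rewrite /clamp (ger0_norm t0) ler0_norm ?subr_le0 //; lra.
Qed.

Lemma clamp_lt0 t : t <= 0 -> clamp t = 0.
Proof. by move=> t0; rewrite /clamp (ler0_norm t0) ler0_norm; lra. Qed.

Lemma clamp_gt1 t : 1 <= t -> clamp t = 1.
Proof. by move=> t1; rewrite /clamp (@ger0_norm _ t) ?ger0_norm; lra. Qed.

Lemma clamp_itv t : 0 <= clamp t <= 1.
Proof.
case: (leP t 0) => [/clamp_lt0 -> | t0]; first by rewrite lexx ler01.
case: (leP t 1) => [t1|/ltW/clamp_gt1 ->]; last by rewrite lexx ler01.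
by rewrite clamp_id ?t1 ltW.
Qed.

Lemma is_arc_global p q A : is_arc p q A ->
  exists g, [/\ continuous g, {in `[0, 1] &, injective g}, g 0 = p /\ g 1 = q,
    g @` `[0, 1] = A & forall t, g t = g (clamp t)].
Proof.
case=> g [cg gi g0 g1 gA]; exists (g \o clamp).
have ce t : t \in `[0, 1] -> clamp t = t by rewrite in_itv; exact: clamp_id.
split.
- move=> t; have ct : `[0, 1]%classic (clamp t) by rewrite /= in_itv /= clamp_itv.
  have /subspace_continuousP/(_ _ ct) cgt := cg.
  move=> P /cgt /= wP.
  have wP' : nbhs (clamp t) [set y | `[0, 1]%classic y -> P (g y)] by exact: wP.
  have : nbhs t (clamp @^-1` [set y | `[0, 1]%classic y -> P (g y)]).
    exact: clamp_continuous.
  apply: filterS => s /=; apply.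
  by rewrite in_itv /= clamp_itv.
- by move=> s t s01 t01 /=; rewrite !ce //; exact: gi.
- by rewrite /= !clamp_id ?lexx ?ler01.
- rewrite -gA; apply/seteqP; split=> x [t t01 <-]; exists t => //=; by rewrite ce.
- by move=> t /=; rewrite (@clamp_id (clamp t)) // clamp_itv.
Qed.

Lemma is_arc_reparam g (a b : R) : a < b -> continuous g ->
  {in `[a, b] &, injective g} -> is_arc (g a) (g b) (g @` `[a, b]).
Proof.
move=> ab cg gi; exists (fun t => g (a + t * (b - a))).
have ba : 0 < b - a by rewrite subr_gt0.
have aff (t : R) : t \in `[0, 1] -> a + t * (b - a) \in `[a, b].
  by rewrite !in_itv /= => /andP[t0 t1]; apply/andP; split; nra.
split.
- apply: continuous_subspaceT => t; apply: continuous_comp; last exact: cg.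
  by apply: cvgD; [exact: cvg_cst|apply: cvgMr_tmp; exact: cvg_id].
- move=> s t s01 t01 /(gi _ _ (aff _ s01) (aff _ t01)) /addrI.
  by apply: mulIf; rewrite gt_eqF.
- by rewrite mul0r addr0.
- by rewrite mul1r addrC subrK.
apply/seteqP; split=> x [t t01 <-].
  by exists (a + t * (b - a)) => //; exact: aff.
exists ((t - a) / (b - a)); last by rewrite divfK ?gt_eqF // addrC subrK.
move: t01; rewrite /= !in_itv /= => /andP[at_ tb].
by rewrite ler_pdivrMr // mul1r lerB // divr_ge0 ?subr_ge0 // ltW // -subr_gt0.
Qed.

Lemma is_arc_rev p q A : is_arc p q A -> is_arc q p A.
Proof.
case/is_arc_global => g [cg gi [g0 g1] gA _].
have sg (t : R) : t \in `[0, 1] -> 1 - t \in `[0, 1] :> bool.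
  by rewrite !in_itv /= => /andP[t0 t1]; apply/andP; split; lra.
exists (fun t => g (1 - t)); split.
- apply: continuous_subspaceT => t; apply: continuous_comp; last exact: cg.
  by apply: cvgB; [exact: cvg_cst|exact: cvg_id].
- by move=> s t s01 t01 /(gi _ _ (sg _ s01) (sg _ t01)) /addrI /oppr_inj.
- by rewrite subr0.
- by rewrite subrr.
rewrite -gA; apply/seteqP; split=> x [t t01 <-].
  by exists (1 - t) => //; exact: sg.
by exists (1 - t); [exact: sg | rewrite opprB addrC subrK].
Qed.

Lemma is_arc_source p q A : is_arc p q A -> A p.
Proof. by case=> g [_ _ <- _ <-]; exists 0 => //=; rewrite in_itv /= lexx ler01. Qed.

Lemma is_arc_target p q A : is_arc p q A -> A q.
Proof. by move/is_arc_rev/is_arc_source. Qed.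

Lemma is_arc_compact p q A : is_arc p q A -> compact A.
Proof.
case=> g [cg _ _ _ <-]; apply: continuous_compact => //; exact: segment_compact.
Qed.

Lemma is_arc_closed p q A : is_arc p q A -> closed A.
Proof. by move/is_arc_compact; apply: compact_closed; exact: norm_hausdorff. Qed.

Lemma is_arc_image p q A (f : R * R -> R * R) : continuous f -> injective f ->
  is_arc p q A -> is_arc (f p) (f q) (f @` A).
Proof.
move=> cf fi /is_arc_global[g [cg gi [<- <-] <- _]]; exists (f \o g).
split => //; last by rewrite image_comp.
- apply: continuous_subspaceT => t; apply: continuous_comp; [exact: cg|exact: cf].
- by move=> s t s01 t01 /fi gst; exact: gi.
Qed.

Lemma is_arc_cat p q r A B : is_arc p q A -> is_arc q r B ->
  A `&` B `<=` [set q] -> is_arc p r (A `|` B).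
Proof.
case/is_arc_global => g [cg gi [g0 g1] gA gc].
case/is_arc_global => h [ch hi [h0 h1] hB hc] AB.
(* [g] is constantly [q] after time 1 and [h] constantly [q] before time 0, so
   this sum follows [g] and then [h]. *)
pose k (t : R) : R * R := g t + h (t - 1) - q.
have k1 t : t <= 1 -> k t = g t.
  by move=> t1; rewrite /k hc clamp_lt0 ?subr_le0// h0 addrK.
have k2 t : 1 <= t -> k t = h (t - 1).
  by move=> t1; rewrite /k gc clamp_gt1// g1 addrC addKr.
have ch1 : continuous ((fun t : R => h (t - 1)) : R -> R * R).
  move=> t; apply: (@continuous_comp _ _ _ (fun u : R => u - 1) h); last exact: ch.
  by apply: cvgB; [exact: cvg_id|exact: cvg_cst].
have ck : continuous k.
  move=> t; apply: cvgB; last exact: cvg_cst.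
  by apply: cvgD; [exact: cg|exact: ch1].
have in1 t : 0 <= t -> t <= 1 -> A (k t).
  by move=> t0 t1; rewrite k1 // -gA; exists t => //=; rewrite in_itv /= t0 t1.
have in2 t : 1 <= t -> t <= 2 -> B (k t).
  move=> t0 t1; rewrite k2 // -hB; exists (t - 1) => //=; rewrite in_itv /=.
  by apply/andP; split; lra.
have k1q : k 1 = q by rewrite k1.
have inj1 : {in `[0, 1] &, injective k}.
  move=> s t /[dup] s01 /itvP s01' /[dup] t01 /itvP t01'.
  by rewrite !k1 ?s01' ?t01' //; exact: gi.
have inj2 : {in `[1, 2] &, injective k}.
  move=> s t; rewrite !in_itv /= => /andP[s1 s2] /andP[t1 t2].
  rewrite !k2 // => hst; apply: (addIr (- 1)); apply: hi => //.
    by rewrite in_itv /=; apply/andP; split; lra.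
  by rewrite in_itv /=; apply/andP; split; lra.
have cross s t : 0 <= s -> s <= 1 -> 1 <= t -> t <= 2 -> k s = k t -> s = t.
  move=> s0 s1 t1 t2 kst.
  have kq : k s = q by apply: AB; split; [exact: in1 | rewrite kst; exact: in2].
  have -> : s = 1 by apply: inj1; rewrite ?in_itv /= ?s0 ?s1 ?lexx ?ler01// kq k1q.
  by apply: inj2; rewrite ?in_itv /= ?t1 ?t2 ?lexx ?ler1n// -kst kq k1q.
have ki : {in `[0, 2] &, injective k}.
  move=> s t; rewrite !in_itv /= => /andP[s0 s2] /andP[t0 t2] kst.
  case: (leP s 1) => [s1|/ltW s1]; case: (leP t 1) => [t1|/ltW t1].
  - by apply: inj1; rewrite ?in_itv /= ?s0 ?t0.
  - exact: cross.
  - by apply/esym/cross.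
  - by apply: inj2; rewrite ?in_itv /= ?s1 ?t1.
have := is_arc_reparam (ltr0n R 2) ck ki.
rewrite k1 // g0 k2 ?ler1n // -[X in h X]/((1 + 1) - 1) addrK h1.
suff -> : k @` `[0, 2] = A `|` B by [].
apply/seteqP; split=> x.
  case=> t /=; rewrite in_itv /= => /andP[t0 t2] <-.
  by case: (leP t 1) => [t1|/ltW t1]; [left; exact: in1|right; exact: in2].
case; rewrite -?gA -?hB.
  move=> [t /= /[!in_itv] /= /andP[t0 t1] <-]; exists t; rewrite ?k1 //=.
  by rewrite in_itv /= t0; lra.
move=> [t /= /[!in_itv] /= /andP[t0 t1] <-]; exists (t + 1).
  by rewrite /= in_itv /=; apply/andP; split; lra.
by rewrite k2 ?addrK // lerDr.
Qed.

Lemma is_arc_split p q r A : is_arc p q A -> A r -> r <> p -> r <> q ->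
  exists B C, [/\ is_arc p r B, is_arc r q C, A = B `|` C & B `&` C `<=` [set r]].
Proof.
case/is_arc_global => g [cg gi [<- <-] <- _] [t /= t01 <-] tp tq.
move: (t01); rewrite in_itv /= => /andP[t0 t1].
have {}t0 : 0 < t by rewrite lt_neqAle t0 andbT; apply/eqP => t0'; apply: tp; rewrite -t0'.
have {}t1 : t < 1 by rewrite lt_neqAle t1 andbT; apply/eqP => t1'; apply: tq; rewrite -t1'.
have s1 (u : R) : u \in `[0, t] -> u \in `[0, 1].
  by rewrite !in_itv /= => /andP[-> u2] /=; rewrite (le_trans u2) ?ltW.
have s2 (u : R) : u \in `[t, 1] -> u \in `[0, 1].
  by rewrite !in_itv /= => /andP[u2 ->]; rewrite andbT (le_trans _ u2) ?ltW.
exists (g @` `[0, t]), (g @` `[t, 1]); split.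
- by apply: is_arc_reparam => // u u' /s1 h /s1 h'; exact: gi.
- by apply: is_arc_reparam => // u u' /s2 h /s2 h'; exact: gi.
- apply/seteqP; split=> [x|x [] []].
  + case=> u /= u01 <-; case: (leP u t) => [ut|/ltW ut]; [left|right]; exists u => //=;
    by move: u01; rewrite !in_itv /= ut => /andP[u0 u1]; rewrite ?u0 ?u1.
  + by move=> u /= /s1 u01 <-; exists u.
  + by move=> u /= /s2 u01 <-; exists u.
- move=> x [[u /= u1 <-] [w /= w1]] /(gi _ _ (s2 _ w1) (s1 _ u1)) wu.
  subst w; congr g; apply/le_anti; move: u1 w1.
  by rewrite !in_itv /= => /andP[_ ->] /andP[-> _].
Qed.

Lemma first_hit_time g C : continuous g -> closed C -> ~ C (g 0) -> C (g 1) ->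
  exists s : R, [/\ 0 < s, s <= 1, C (g s) &
    forall t, 0 <= t -> t < s -> ~ C (g t)].
Proof.
move=> cg cC C0 C1; pose E := [set t : R | C (g t)] `&` `[0, 1].
have cE : compact E.
  rewrite /E setIC; apply: compact_closedI; first exact: segment_compact.
  by apply: (@closed_comp _ _ g C) => // t _; exact: cg.
have nE : E !=set0 by exists 1; split => //=; rewrite in_itv /= lexx ler01.
have cid : {within E, continuous (idfun : R -> R)}.
  by apply: continuous_subspaceT => x; exact: cvg_id.
have [s /[!inE] -[/= Cs /[!in_itv] /= /andP[s0 s1]] smin] := compact_EVT_min nE cE cid.
exists s; split => //.
  by rewrite lt_neqAle s0 andbT; apply/eqP => e; apply: C0; rewrite e.
move=> t t0 ts Ct; have : t \in E.
  rewrite inE; split => //=; rewrite in_itv /= t0 /=.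
  exact/(le_trans _ s1)/ltW.
by move/smin => /=; rewrite leNgt ts.
Qed.

(** [B] is the part of [A] up to its first point in [C], and [L] the part after
    it. The closed set [L] misses [p], so [A] and [B] agree near [p]. *)
Lemma is_arc_first_hit p q A C : is_arc p q A -> closed C -> ~ C p -> C q ->
  exists r B L, [/\ is_arc p r B, B `<=` A, C r, B `&` C `<=` [set r] &
    [/\ closed L, ~ L p & A `<=` B `|` L]].
Proof.
case/is_arc_global => g [cg gi [<- <-] <- _] cC C0 C1.
have [s [s0 s1 Cs smin]] := first_hit_time cg cC C0 C1.
have sub (u : R) : u \in `[0, s] -> u \in `[0, 1].
  by rewrite !in_itv /= => /andP[-> u2] /=; rewrite (le_trans u2).
have sub2 (u : R) : u \in `[s, 1] -> u \in `[0, 1].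
  by rewrite !in_itv /= => /andP[u1 ->] /=; rewrite (le_trans (ltW s0)).
exists (g s), (g @` `[0, s]), (g @` `[s, 1]); split => //.
- by apply: is_arc_reparam => // u u' /sub h /sub h'; exact: gi.
- by move=> x [u /= /sub u01 <-]; exists u.
- move=> _ [[t /= /[!in_itv] /= /andP[t0 ts] <-] Ct].
  congr g; apply/le_anti; rewrite ts /= leNgt; apply/negP => lt_ts.
  exact: (smin t).
split.
- apply: compact_closed; first exact: norm_hausdorff.
  apply: continuous_compact; last exact: segment_compact.
  exact: continuous_subspaceT.
- case=> t /= ts /(gi _ _ (sub2 _ ts)) t0; move: ts.
  by rewrite in_itv /= t0 ?leNgt ?s0 // in_itv /= lexx ler01.
- move=> _ [t /= t01 <-]; move: t01; rewrite in_itv /= => /andP[t0 t1].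
  by case: (leP t s) => [ts|/ltW ts]; [left|right]; exists t => //=;
    rewrite in_itv /= ?t0 ?t1 ?ts.
Qed.

Lemma is_arc_connected p q A : is_arc p q A -> connected A.
Proof.
case=> g [cg _ _ _ <-].
by apply: connected_continuous_connected => //; exact: segment_connected.
Qed.

(** When the closed set is a sublevel set of a continuous function, the level is
    attained exactly at the first hit: a smaller value there would, by
    connectedness of [B], force an earlier point at the level. *)
Lemma is_arc_first_level p q A (phi : R * R -> R) (c : R) : continuous phi ->
  is_arc p q A -> c < phi p -> phi q <= c ->
  exists r B L, [/\ is_arc p r B, B `<=` A, phi r = c,
    forall b, B b -> phi b <= c -> b = r &
    [/\ closed L, ~ L p & A `<=` B `|` L]].
Proof.
move=> cphi aA pp pq.
have cphic : closed [set x | phi x <= c].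
  by apply: (@closed_comp _ _ phi [set x | x <= c]) => [t _|];
    [exact: cphi|exact: closed_le].
have npp : ~ [set x | phi x <= c] p by rewrite /= leNgt pp.
have [r [B [L [aB BA pr Br HL]]]] := is_arc_first_hit aA cphic npp pq.
exists r, B, L; split => //; last by move=> b Bb bc; apply: Br.
apply/le_anti; rewrite pr /= leNgt; apply/negP => rc.
have /connected_intervalP : connected (phi @` B).
  apply: connected_continuous_connected; first exact: is_arc_connected aB.
  exact: continuous_subspaceT.
move=> /(_ (phi r) (phi p)) H.
have [|||b Bb pb] := H _ _ c.
- by exists r => //; exact: is_arc_target aB.
- by exists p => //; exact: is_arc_source aB.
- by rewrite !ltW.
by move: rc; rewrite -pb (Br b) ?ltxx //; split => //=; rewrite pb.
Qed.

End Arcs.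

(** * Dragging a point along a connected set *)

Section Drag.
Variable R : realType.
Implicit Types (p q r c w x y : R * R) (K C : set (R * R)).

(** The displacement of [c] is [rho *: u]; it fades out linearly to zero at distance
    [rho] from [c]. *)
Definition bump (c : R * R) (rho : R) (u x : R * R) : R * R :=
  x + Num.max 0 (rho - `|x - c|) *: u.

Lemma bump_continuous c rho u : continuous (bump c rho u).
Proof.
move=> x; apply: cvgD; first exact: cvg_id.
apply: cvgZr_tmp.
apply: (@continuous_max _ _ (fun=> 0) (fun y => rho - `|y - c|)).
  exact: cvg_cst.
apply: cvgB; first exact: cvg_cst.
by apply: cvg_norm; apply: cvgB; [exact: cvg_id|exact: cvg_cst].
Qed.

(** The displacement is a Lipschitz function with constant [`|u|] below 1, so it
    cannot bring two points together. *)
Lemma bump_injective c rho u : `|u| < 1 -> injective (bump c rho u).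
Proof.
move=> u1 x y; rewrite /bump.
set a := Num.max _ _; set b := Num.max _ _ => xy.
have eq1 : x - y = (b - a) *: u.
  rewrite scalerBl; apply/eqP; rewrite subr_eq addrAC eq_sym subr_eq.
  by rewrite xy addrC.
have ab : `|b - a| <= `|x - y|.
  have /ler_normlP[] : `| `|x - c| - `|y - c| | <= `|x - y|.
    by rewrite (le_trans (ler_dist_dist _ _)) // opprB addrA subrK.
  rewrite /a /b => h1 h2; apply/ler_normlP.
  by case: (leP 0 (rho - `|x - c|)); case: (leP 0 (rho - `|y - c|)) => *;
    have := normr_ge0 (x - y); split; lra.
have : `|x - y| <= `|x - y| * `|u| by rewrite {1}eq1 normrZ ler_wpM2r.
have [/eqP|xy0] := eqVneq `|x - y| 0; first by rewrite normr_eq0 subr_eq0 => /eqP.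
by rewrite ler_pMr ?leNgt ?u1 // lt_neqAle eq_sym xy0 /=.
Qed.

Lemma drag_ball c p (rho : R) : `|p - c| < rho ->
  exists f : R * R -> R * R, [/\ continuous f, injective f, f c = p &
    forall x, rho <= `|x - c| -> f x = x].
Proof.
move=> pc; have rho0 : 0 < rho by exact: le_lt_trans pc.
exists (bump c rho (rho^-1 *: (p - c))); split.
- exact: bump_continuous.
- apply: bump_injective; rewrite normrZ ger0_norm ?invr_ge0 ?ltW //.
  by rewrite mulrC ltr_pdivrMr // mul1r.
- rewrite /bump subrr normr0 subr0 max_r ?ltW // scalerA mulfV ?gt_eqF //.
  by rewrite scale1r addrC subrK.
- by move=> x xc; rewrite /bump max_l ?subr_le0 // scale0r addr0.
Qed.

(** The points to which [w] can be moved by maps fixing [K] form a relatively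
    clopen part of [C]: within a ball off [K], all points can be moved to each
    other by bumps. Injectivity matters beyond the image of arcs being arcs: since
    [f] fixes [K], no point off [K] can be sent into [K]. *)
Lemma drag K C w q : closed K -> connected C -> C `&` K = set0 ->
  C w -> C q -> exists f : R * R -> R * R, [/\ continuous f, injective f,
    forall x, K x -> f x = x & f w = q].
Proof.
move=> cK cC CK Cw Cq.
pose E := [set p | exists f : R * R -> R * R, [/\ continuous f, injective f,
    forall x, K x -> f x = x & f w = p]].
have CnK p : C p -> ~ K p by move=> Cp Kp; have : set0 p by rewrite -CK.
have loc p : C p -> exists2 e : R, 0 < e &
    forall x y, `|p - x| < e -> `|p - y| < e -> E x -> E y.
  move=> /CnK nKp.
  have : nbhs p (~` K) by apply: open_nbhs_nbhs; split => //; exact: closed_openC.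
  case/nbhs_ballP => e /= e0 be; exists (e / 3); first by rewrite divr_gt0.
  move=> x y px py [f [cf fi fK fw]].
  have xy : `|y - x| < e / 3 + e / 3.
    have -> : y - x = (p - x) - (p - y) by rewrite opprB [RHS]addrC addrA subrK.
    by rewrite (le_lt_trans (ler_normB _ _)) // ltrD.
  have [h [ch hi hx hK]] := drag_ball xy.
  exists (h \o f); split => //=.
  - by move=> z; apply: continuous_comp; [exact: cf|exact: ch].
  - by move=> z t /hi /fi.
  - move=> z Kz; rewrite fK // hK // leNgt; apply/negP => zx.
    apply: (be z) => //; rewrite -ball_normE /=.
    have -> : p - z = (p - x) - (z - x) by rewrite opprB addrA subrK.
    rewrite (le_lt_trans (ler_normB _ _)) //; lra.
  - by rewrite fw.
have EC : C `&` E = C.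
  apply: cC.
  - by exists w; split => //; exists id; split => // x; exact: cvg_id.
  - exists (interior E); first exact: open_interior.
    apply/seteqP; split=> p [Cp Ep]; split => //; last exact: interior_subset.
    have [e e0 He] := loc _ Cp; apply/nbhs_ballP; exists e => //= y.
    by rewrite -ball_normE /= => py; apply: (He p) => //; rewrite subrr normr0.
  - exists (closure E); first exact: closed_closure.
    apply/seteqP; split=> p [Cp Ep]; split => //; first exact: subset_closure.
    have [e e0 He] := loc _ Cp.
    have [y [Ey]] := Ep _ (nbhsx_ballx p e e0).
    rewrite -ball_normE /= => py; apply: (He y) => //; by rewrite subrr normr0.
by have : (C `&` E) q by [rewrite EC]; case.
Qed.

End Drag.

(** * Segments and round discs in the plane *)

Section Plane.
Variable R : realType.
Implicit Types (p q r c u v w x y z a : R * R) (K L C : set (R * R)).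

Definition sqn u : R := u.1 ^+ 2 + u.2 ^+ 2.
Definition cross u v : R := u.1 * v.2 - u.2 * v.1.
Definition seg p q : set (R * R) := (fun t : R => p + t *: (q - p)) @` `[0, 1].

Lemma pairE (p q : R * R) : p.1 = q.1 -> p.2 = q.2 -> p = q.
Proof. by case: p q => [? ?] [? ?] /= -> ->. Qed.

Lemma fstZ (t : R) u : (t *: u).1 = t * u.1. Proof. by []. Qed.
Lemma sndZ (t : R) u : (t *: u).2 = t * u.2. Proof. by []. Qed.
Lemma fstD u v : (u + v).1 = u.1 + v.1. Proof. by []. Qed.
Lemma sndD u v : (u + v).2 = u.2 + v.2. Proof. by []. Qed.
Lemma fstN u : (- u).1 = - u.1. Proof. by []. Qed.
Lemma sndN u : (- u).2 = - u.2. Proof. by []. Qed.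
Definition vecE := (fstZ, sndZ, fstD, sndD, fstN, sndN).

Lemma sqn_ge0 u : 0 <= sqn u.
Proof. by rewrite addr_ge0 ?sqr_ge0. Qed.

Lemma sqn0 : sqn (0 : R * R) = 0.
Proof. by rewrite /sqn /= expr0n addr0. Qed.

Lemma sqn_eq0 u : sqn u = 0 -> u = 0.
Proof.
move=> /eqP; rewrite paddr_eq0 ?sqr_ge0 // !sqrf_eq0 => /andP[/eqP h1 /eqP h2].
exact: pairE.
Qed.

Lemma sqn_gt0 u : u <> 0 -> 0 < sqn u.
Proof. by move=> u0; rewrite lt_neqAle sqn_ge0 andbT; apply/eqP => /esym/sqn_eq0. Qed.

Lemma sqnZ (t : R) u : sqn (t *: u) = t ^+ 2 * sqn u.
Proof. by rewrite /sqn !vecE; ring. Qed.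

Lemma crossZr (t : R) u v : cross u (t *: v) = t * cross u v.
Proof. by rewrite /cross !vecE; ring. Qed.

Lemma crossDr u v w : cross u (v + w) = cross u v + cross u w.
Proof. by rewrite /cross !vecE; ring. Qed.

Lemma crossvv u : cross u u = 0.
Proof. by rewrite /cross; ring. Qed.

Lemma fst_continuous : continuous (fun p : R * R => p.1).
Proof. by move=> p; exact: cvg_fst. Qed.

Lemma snd_continuous : continuous (fun p : R * R => p.2).
Proof. by move=> p; exact: cvg_snd. Qed.

Lemma sqn_continuous c : continuous (fun p => sqn (p - c)).
Proof.
move=> p; apply: cvgD; rewrite /GRing.exp /=.
  by apply: cvgM; apply: cvgB;
    [exact: fst_continuous|exact: cvg_cst|exact: fst_continuous|exact: cvg_cst].
by apply: cvgM; apply: cvgB;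
  [exact: snd_continuous|exact: cvg_cst|exact: snd_continuous|exact: cvg_cst].
Qed.

Lemma line_continuous p u : continuous (fun t : R => p + t *: u).
Proof. by move=> t; apply: cvgD; [exact: cvg_cst|apply: cvgZr_tmp; exact: cvg_id]. Qed.

Lemma lineI p u (s t : R) : u <> 0 -> p + s *: u = p + t *: u -> s = t.
Proof.
move=> u0 /addrI /eqP; rewrite -subr_eq0 -scalerBl scaler_eq0 => /orP[]/eqP //.
by move/eqP; rewrite subr_eq0 => /eqP.
Qed.

Lemma segE p q :
  seg p q = [set x | exists t : R, [/\ 0 <= t, t <= 1 & x = p + t *: (q - p)]].
Proof.
apply/seteqP; split=> x; first by case=> t /= /[!in_itv] /= /andP[t0 t1] <-; exists t.
by case=> t [t0 t1 ->]; exists t => //=; rewrite in_itv /= t0 t1.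
Qed.

Lemma is_arc_seg p q : p <> q -> is_arc p q (seg p q).
Proof.
move=> pq; have u0 : q - p <> 0 by move/eqP; rewrite subr_eq0 => /eqP /esym.
exists (fun t => p + t *: (q - p)); split => //.
- apply: continuous_subspaceT; exact: line_continuous.
- by move=> s t _ _; exact: lineI.
- by rewrite scale0r addr0.
- by rewrite scale1r addrC subrK.
Qed.

Lemma segC p q : seg p q = seg q p.
Proof.
rewrite !segE; apply/seteqP; split=> x [t [t0 t1 ->]]; exists (1 - t);
  (split; [lra|lra|by apply: pairE; rewrite !vecE; ring]).
Qed.

(** Round discs rather than the balls of the product norm: these are the
    strictly convex ones. *)
Lemma disc_avoid K r : closed K -> ~ K r ->
  exists2 c : R, 0 < c & forall p, sqn (p - r) <= c -> ~ K p.
Proof.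
move=> cK nKr.
have : nbhs r (~` K) by apply: open_nbhs_nbhs; split => //; exact: closed_openC.
case/nbhs_ballP => e /= e0 be; exists ((e / 2) ^+ 2).
  by rewrite exprn_gt0 // divr_gt0.
move=> p pr; apply: be.
have [h1 h2] : (p.1 - r.1) ^+ 2 <= (e / 2) ^+ 2 /\
               (p.2 - r.2) ^+ 2 <= (e / 2) ^+ 2.
  by split; apply: le_trans pr; rewrite /sqn !vecE;
    have := sqr_ge0 (p.1 - r.1); have := sqr_ge0 (p.2 - r.2); lra.
have aux (s t : R) : (s - t) ^+ 2 <= (e / 2) ^+ 2 -> `|t - s| < e.
  move=> h; rewrite distrC; apply: (@le_lt_trans _ _ (e / 2)); last by lra.
  have e2 : 0 <= e / 2 by lra.
  by rewrite -ler_sqr ?nnegrE ?normr_ge0 // real_normK // num_real.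
by split; rewrite /ball /=; apply: aux.
Qed.

(** Two directions of equal length lie on the same ray only if they are equal, and
    a ray is closed. *)
Lemma ray_avoid d d' : sqn d = sqn d' -> 0 < sqn d -> d <> d' ->
  \forall u \near d, forall k : R, 0 <= k -> u <> k *: d'.
Proof.
move=> dd d0 ne.
pose C := [set u | cross d' u = 0] `&` [set u | 0 <= u.1 * d'.1 + u.2 * d'.2].
have cC : closed C.
  apply: closedI.
    apply: (@closed_comp _ _ (cross d') [set x | x = 0]); last exact: closed_eq.
    move=> u _; apply: cvgB; apply: cvgMl_tmp; [exact: snd_continuous|exact: fst_continuous].
  apply: (@closed_comp _ _ (fun u => u.1 * d'.1 + u.2 * d'.2) [set x | 0 <= x]);
    last exact: closed_ge.
  move=> u _; apply: cvgD; apply: cvgMr_tmp; [exact: fst_continuous|exact: snd_continuous].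
have nC : ~ C d.
  case=> /= c0 dt; apply: ne.
  pose D := d.1 * d'.1 + d.2 * d'.2.
  have : D ^+ 2 = sqn d' ^+ 2.
    (* Lagrange's identity *)
    have -> : D ^+ 2 = sqn d * sqn d' - (cross d' d) ^+ 2 by rewrite /sqn /cross /D; ring.
    by rewrite c0 dd; ring.
  move=> /eqP; rewrite eqrXn2 ?sqn_ge0 // => /eqP DE.
  apply/eqP; rewrite -subr_eq0; apply/eqP/sqn_eq0.
  have -> : sqn (d - d') = sqn d + sqn d' - D - D by rewrite /sqn /D !vecE; ring.
  by rewrite DE dd; ring.
have : nbhs d (~` C) by apply: open_nbhs_nbhs; split => //; exact: closed_openC.
apply: filterS => u nCu k k0 uk; apply: nCu; rewrite uk; split => /=.
  by rewrite crossZr crossvv mulr0.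
by have := sqn_ge0 d'; rewrite /sqn /= => h; rewrite -!mulrA -!expr2 -mulrDr mulr_ge0.
Qed.

(** The tube lemma for the segment from [x] to [x + d], a compact set. *)
Lemma tube_avoid L x d : closed L ->
  (forall t : R, 0 <= t <= 1 -> ~ L (x + t *: d)) ->
  \forall u \near d, forall t : R, 0 <= t <= 1 -> ~ L (x + t *: u).
Proof.
move=> cL Ld.
have /compact_near_coveringP/(_ _ (nbhs d) (fun u t => ~ L (x + t *: u))) :=
  @segment_compact R 0 1.
move=> /(_ _) H.
have : \forall u \near d, `[0, 1]%classic `<=` (fun t => ~ L (x + t *: u)).
  apply: H => t /=; rewrite in_itv /= => t01.
  have cf : continuous (fun w : R * (R * R) => x + w.1 *: w.2).
    by move=> w; apply: cvgD; [exact: cvg_cst|apply: cvgZ; [exact: cvg_fst|exact: cvg_snd]].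
  have nb : nbhs (x + (t, d).1 *: (t, d).2) (~` L).
    by apply: open_nbhs_nbhs; split; [exact: closed_openC|exact: Ld].
  exact: (cf (t, d) _ nb).
by apply: filterS => u Hu t t01; apply: Hu => /=; rewrite in_itv.
Qed.

End Plane.

(** * Two nearby segments into a branch point *)

Section Contraction.
Variable R : realType.
Implicit Types (p q r c u v w x y z a d : R * R) (A B K L C X Y Z P Q : set (R * R)).

Lemma collinear a y : a <> 0 -> cross a y = 0 -> exists m : R, y = m *: a.
Proof.
move=> /sqn_gt0 a0 ay; exists ((a.1 * y.1 + a.2 * y.2) / sqn a).
have an0 : sqn a != 0 by rewrite gt_eqF.
apply: pairE; rewrite !vecE mulrAC; apply: (canRL (mulfK an0)).
  have -> : y.1 * sqn a = (a.1 * y.1 + a.2 * y.2) * a.1 - a.2 * cross a y.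
    by rewrite /sqn /cross; ring.
  by rewrite ay mulr0 subr0.
have -> : y.2 * sqn a = (a.1 * y.1 + a.2 * y.2) * a.2 + a.1 * cross a y.
  by rewrite /sqn /cross; ring.
by rewrite ay mulr0 addr0.
Qed.

(** Seen from a branch point placed at the origin with arms in directions [a], [y]
    and [z], a segment from [a] to a point of the [y]-arm close to the origin
    does not cross the [z]-arm: the triangle spanned by [a] and [y] is
    nondegenerate and does not contain the direction [z]. *)
Definition clear_turn a y z := cross a y <> 0 /\
  forall s t m : R, 0 < s -> 0 < t -> 0 <= m -> s *: a + t *: y <> m *: z.

(** If [z] lay in the cone of [a] and [y], and [y] in the cone of [a] and [z], then
    substituting one relation in the other would make [a] and [z] parallel. *)
Lemma clear_turn_total a y z : a <> 0 -> sqn y = sqn z -> 0 < sqn y -> y <> z ->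
  (forall k : R, 0 < k -> a <> k *: y) -> (forall k : R, 0 < k -> a <> k *: z) ->
  clear_turn a y z \/ clear_turn a z y.
Proof.
move=> a0 yz y0 nyz ay az.
have flat u v : cross a u <> 0 -> cross a v = 0 -> clear_turn a u v.
  move=> au av; split => // s t m s0 t0 m0 /(congr1 (cross a)).
  rewrite crossDr !crossZr crossvv av !mulr0 add0r => /eqP.
  by rewrite mulf_eq0 gt_eqF //= => /eqP.
have [cy|/eqP cy] := eqVneq (cross a y) 0; have [cz|/eqP cz] := eqVneq (cross a z) 0.
- have [m ym] := collinear a0 cy; have [n zn] := collinear a0 cz.
  have mn : m != n by apply/eqP => mn; apply: nyz; rewrite ym zn mn.
  have pos k u : u = k *: a -> 0 < k -> exists2 l : R, 0 < l & a = l *: u.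
    move=> -> k0; exists k^-1; first by rewrite invr_gt0.
    by rewrite scalerA mulVf ?scale1r // gt_eqF.
  have : (m - n) * (m + n) = 0.
    apply: (mulIf (x := sqn a)); first by rewrite gt_eqF // sqn_gt0.
    by rewrite mul0r -subr_sqr mulrBl -!sqnZ -ym -zn yz subrr.
  move/eqP; rewrite mulf_eq0 subr_eq0 (negbTE mn) /= => /eqP nm.
  have m0 : m != 0 by apply/eqP => m0; move: y0; rewrite ym sqnZ m0 expr0n mul0r ltxx.
  case: (ltgtP m 0) m0 => // m0 _.
    by have [||l l0 al] := pos n z => //; [lra|case: (az l l0)].
  by have [||l l0 al] := pos m y => //; case: (ay l l0).
- by right; exact: flat.
- by left; exact: flat.
case: (pselect (clear_turn a y z)) => [|nc]; [by left|right]; split => //.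
move=> s' t' m' s0' t0' m0' e'; apply: nc; split => // s t m s0 t0 m0 e.
have E : (t * s' + m' * s) *: a = (m * m' - t * t') *: z.
  have e1 := congr1 (fun v => v.1) e; have e2 := congr1 (fun v => v.2) e.
  have e1' := congr1 (fun v => v.1) e'; have e2' := congr1 (fun v => v.2) e'.
  rewrite !vecE in e1 e2 e1' e2'; apply: pairE; rewrite !vecE.
    have -> : (t * s' + m' * s) * a.1 = t * (s' * a.1 + t' * z.1)
      + m' * (s * a.1 + t * y.1) - m' * t * y.1 - t * t' * z.1 by ring.
    by rewrite e1 e1'; ring.
  have -> : (t * s' + m' * s) * a.2 = t * (s' * a.2 + t' * z.2)
    + m' * (s * a.2 + t * y.2) - m' * t * y.2 - t * t' * z.2 by ring.
  by rewrite e2 e2'; ring.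
have /eqP := congr1 (cross a) E; rewrite !crossZr crossvv mulr0 eq_sym mulf_eq0.
case/orP => /eqP // k0; move: E; rewrite k0 scale0r => /eqP.
rewrite scaler_eq0 => /orP[]/eqP // h.
have : 0 < t * s' by rewrite mulr_gt0.
have : 0 <= m' * s by rewrite mulr_ge0 // ltW.
lra.
Qed.

(** The endgame of the contraction. The branch point [r] sees [x] along a segment
    and has arms [Y] and [Z], which stop on a circle around [r], at [py] and [pz];
    inside the disc they are continued by radii. The arc to [z] goes straight
    through [r]. The arc to [y] goes to a point [s] of the radius towards [py],
    so close to [r] that the segment from [x] to [s] still avoids everything that
    the segment from [x] to [r] avoids; for the obstacles [K] accumulating at [x]
    this is the free cone around [r - x], for the arms it is compactness. *)
Lemma contract_clear K x y z r py pz (c : R) Y Z : K x ->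
  (\forall u \near r - x, forall t : R, 0 < t -> t <= 1 -> ~ K (x + t *: u)) ->
  0 < c -> (forall p, sqn (p - r) <= c -> ~ K p) ->
  is_arc y py Y -> is_arc z pz Z ->
  (forall p, Y p -> K p -> p = y) -> (forall p, Z p -> K p -> p = z) ->
  (forall p, Y p -> Z p -> False) ->
  sqn (py - r) = c -> (forall p, Y p -> sqn (p - r) <= c -> p = py) ->
  sqn (pz - r) = c -> (forall p, Z p -> sqn (p - r) <= c -> p = pz) ->
  (forall t : R, 0 <= t <= 1 -> ~ (Y `|` Z) (x + t *: (r - x))) ->
  (forall k : R, 0 < k -> x - r <> k *: (pz - r)) ->
  clear_turn (x - r) (py - r) (pz - r) ->
  exists P Q, [/\ is_arc x y P, is_arc x z Q,
    forall p, P p -> K p -> p = x \/ p = y,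
    forall p, Q p -> K p -> p = x \/ p = z &
    forall p, P p -> Q p -> p = x].
Proof.
move=> Kx cone c0 DK aY aZ YK ZK YZ pyc DY pzc DZ sL nz [cr cl].
have cL : closed (Y `|` Z) by apply: closedU; [exact: is_arc_closed aY|exact: is_arc_closed aZ].
have near2 := filterI cone (tube_avoid cL sL).
have [e [e0 e1 He]] : exists e : R, [/\ 0 < e, e < 1 &
  (forall t : R, 0 < t -> t <= 1 -> ~ K (x + t *: (r - x + e *: (py - r)))) /\
  (forall t : R, 0 <= t <= 1 -> ~ (Y `|` Z) (x + t *: (r - x + e *: (py - r))))].
  have ct := @line_continuous R (r - x) (py - r) 0.
  have near0 : nbhs (r - x + 0 *: (py - r)) [set u |
     (forall t : R, 0 < t -> t <= 1 -> ~ K (x + t *: u)) /\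
     (forall t : R, 0 <= t <= 1 -> ~ (Y `|` Z) (x + t *: u))].
    by rewrite scale0r addr0; exact: near2.
  have /nbhs_ballP[e /= e0 be] := ct _ near0.
  exists (Num.min (e / 2) (1 / 2)).
  have m0 : 0 < Num.min (e / 2) (1 / 2) by rewrite lt_min !divr_gt0.
  have m1 : Num.min (e / 2) (1 / 2) <= e / 2 by rewrite ge_min lexx.
  have m2 : Num.min (e / 2) (1 / 2) <= 1 / 2 by rewrite ge_min lexx orbT.
  split; [by []|by lra|apply: be].
  by rewrite /ball /= sub0r normrN gtr0_norm //; lra.
case: He; set a := x - r in cr cl nz *; set y' := py - r in cr cl pyc *.
set z' := pz - r in cl pzc nz *.
pose s := r + e *: y'.
have -> : r - x + e *: y' = s - x by apply: pairE; rewrite !vecE; ring.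
move=> sK sYZ.
have a0 : a <> 0.
  move=> a0; apply: (DK x) => //; rewrite -/a a0.
  by rewrite sqn0 ltW.
have Dr p : Y p \/ Z p -> p <> r.
  move=> YZp pr; have h : sqn (p - r) = 0 by rewrite pr subrr sqn0.
  case: YZp => [/DY|/DZ]; rewrite h => /(_ (ltW c0)) e2; move: h.
    by rewrite e2 pyc => h; rewrite h ltxx in c0.
  by rewrite e2 pzc => h; rewrite h ltxx in c0.
have xr : x <> r by move/eqP; rewrite -subr_eq0 => /eqP.
have y'z' : y' <> z'.
  move=> /addIr pyz; apply: (YZ py); first exact: is_arc_target aY.
  by rewrite pyz; exact: is_arc_target aZ.
have y'0 : y' <> 0 by move=> h; rewrite -pyc h sqn0 ltxx in c0.
have z'0 : z' <> 0 by move=> h; rewrite -pzc h sqn0 ltxx in c0.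
have spy : s <> py.
  move=> h; have : e *: y' = 1 *: y' by rewrite scale1r -[LHS](addKr r) -/s h addrC.
  by move/(congr1 (+%R r)) /(lineI y'0) => h1; rewrite h1 ltxx in e1.
have xs : x <> s.
  move=> h; have : cross a a = 0 by exact: crossvv.
  by rewrite {2}/a h addrC addKr crossZr => /eqP; rewrite mulf_eq0 gt_eqF //= => /eqP.
have rpz : r <> pz by move=> h; apply: z'0; rewrite /z' h subrr.
(* Coordinates centred at [r] on the four straight pieces; from here on, all
   intersections of straight pieces are linear algebra. *)
have segxs p : seg x s p ->
    exists t : R, [/\ 0 <= t, t <= 1 & p - r = (1 - t) *: a + (t * e) *: y'].
  rewrite segE => -[t [t0 t1 ->]]; exists t; split => //.
  by apply: pairE; rewrite /s /a !vecE; ring.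
have segspy p : seg s py p -> exists m : R, [/\ e <= m, m <= 1 & p - r = m *: y'].
  rewrite segE => -[t [t0 t1 ->]]; exists (e + t * (1 - e)); split; [nra|nra|].
  by apply: pairE; rewrite /s /y' !vecE; ring.
have segxr p : seg x r p -> exists m : R, [/\ 0 <= m, m <= 1 & p - r = m *: a].
  rewrite segE => -[t [t0 t1 ->]]; exists (1 - t); split; [lra|lra|].
  by apply: pairE; rewrite /a !vecE; ring.
have segrpz p : seg r pz p -> exists m : R, [/\ 0 <= m, m <= 1 & p - r = m *: z'].
  by rewrite segE => -[t [t0 t1 ->]]; exists t; split => //; rewrite addrC addKr.
have in_disc (m : R) u p : 0 <= m -> m <= 1 -> sqn u = c -> p - r = m *: u ->
    sqn (p - r) <= c.
  by move=> m0 m1 uc ->; rewrite sqnZ uc ger_pMl // expr_le1.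
have full (m : R) u u' : 0 <= m -> sqn u = c -> sqn u' = c -> u = m *: u' -> u = u'.
  move=> m0 uc uc' uu; have : m ^+ 2 * c = c by rewrite -{2}uc uu sqnZ uc'.
  move/eqP; rewrite -subr_eq0 -{2}(mul1r c) -mulrBl mulf_eq0 subr_eq0 sqrf_eq1.
  rewrite (gt_eqF c0) orbF => /orP[/eqP m1|/eqP m1]; first by rewrite uu m1 scale1r.
  by move: m0; rewrite m1 oppr_ge0 ler10.
have KD p (m : R) u : 0 <= m -> m <= 1 -> sqn u = c -> p - r = m *: u -> ~ K p.
  by move=> m0 m1 uc pu; apply: DK; exact: in_disc pu.
have xsK p : seg x s p -> K p -> p = x.
  rewrite segE => -[t [t0 t1 ->]]; case: (ltgtP 0 t) t0 => // [t0 _ /sK|<- _ _]; first by case.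
  by rewrite scale0r addr0.
have xrK p : seg x r p -> K p -> p = x.
  have near1 := nbhs_singleton cone.
  rewrite segE => -[t [t0 t1 ->]]; case: (ltgtP 0 t) t0 => // [t0 _ /near1|<- _ _]; first by case.
  by rewrite scale0r addr0.
have xrL p : seg x r p -> Y p \/ Z p -> False.
  rewrite segE => -[t [t0 t1 ->]] h; apply: (sL t) => //; by rewrite t0 t1.
have xsL p : seg x s p -> Y p \/ Z p -> False.
  rewrite segE => -[t [t0 t1 ->]] h; apply: (sYZ t) => //; by rewrite t0 t1.
have disjT p : seg s py p -> Y p -> p = py.
  by move=> /segspy[m [m0 m1 pm]] Yp; apply: DY => //; apply: in_disc pm => //; lra.
have disjT2 p : seg r pz p -> Z p -> p = pz.
  by move=> /segrpz[m [m0 m1 pm]] Yp; apply: DZ => //; apply: in_disc pm => //; lra.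
have aP : is_arc x y (seg x s `|` (seg s py `|` Y)).
  apply: is_arc_cat (is_arc_seg xs) _ _.
    apply: is_arc_cat (is_arc_seg spy) (is_arc_rev aY) _.
    by move=> p [/disjT h /h].
  move=> p [xsp [|Yp]]; last by case: (xsL p xsp); left.
  case/segspy => m [m0 m1 pm]; case/segxs: (xsp) => t [t0 t1 pt].
  have /eqP := congr1 (cross a) pt.
  rewrite pm crossDr !crossZr crossvv mulr0 add0r -subr_eq0 -mulrBl mulf_eq0.
  case/orP => /eqP // mt.
  have t1' : t = 1 by nra.
  move: pt; rewrite t1' subrr scale0r add0r mul1r => pt.
  by rewrite /= /s -pt addrC subrK.
have aQ : is_arc x z (seg x r `|` (seg r pz `|` Z)).
  apply: is_arc_cat (is_arc_seg xr) _ _.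
    apply: is_arc_cat (is_arc_seg rpz) (is_arc_rev aZ) _.
    by move=> p [/disjT2 h /h].
  move=> p [xrp [|Zp]]; last by case: (xrL p xrp); right.
  case/segrpz => m [m0 m1 pm]; case/segxr: (xrp) => t [t0 t1 pt].
  apply/eqP; rewrite -subr_eq0; apply/eqP.
  have [t00|/eqP tn0] := eqVneq t 0; first by rewrite pt t00 scale0r.
  have [m00|/eqP mn0] := eqVneq m 0; first by rewrite pm m00 scale0r.
  case: (nz (m / t)); first by
    rewrite divr_gt0 // lt_neqAle eq_sym; apply/andP; split=> //; exact/eqP.
  by rewrite mulrC -scalerA -pm pt scalerA mulVf ?scale1r //; exact/eqP.
exists (seg x s `|` (seg s py `|` Y)), (seg x r `|` (seg r pz `|` Z)); split => //.
- move=> p [xsp|[/segspy[m [m0 m1 pm]]|Yp]] Kp; first by left; exact: xsK.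
    by case: (@KD p m y') => //; lra.
  by right; exact: YK.
- move=> p [xsp|[/segrpz[m [m0 m1 pm]]|Yp]] Kp; first by left; exact: xrK.
    by case: (@KD p m z').
  by right; exact: ZK.
move=> p [xsp|[spyp|Yp]] [xrp|[rpzp|Zp]].
- case/segxs: xsp => t [t0 t1 pt]; case/segxr: xrp => m [m0 m1 pm].
  have /eqP := congr1 (cross a) pt.
  rewrite pm crossDr !crossZr crossvv !mulr0 add0r eq_sym mulf_eq0.
  case/orP => /eqP //; move/eqP; rewrite mulf_eq0 (gt_eqF e0) orbF => /eqP t00.
  move: pt; rewrite t00 subr0 mul0r scale0r addr0 scale1r /a.
  by move/addIr.
- case/segxs: xsp => t [t0 t1 pt]; case/segrpz: rpzp => m [m0 m1 pm].
  case: (ltgtP t 0) t0 => // [t0 _|t0 _]; last first.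
    move: pt; rewrite t0 subr0 mul0r scale0r addr0 scale1r pm => am.
    have [m00|mn0] := eqVneq m 0; first by case: a0; rewrite -am m00 scale0r.
    by case: (nz m) => //; rewrite lt_neqAle eq_sym mn0.
  case: (ltgtP t 1) t1 => // [t1 _|t1 _].
    by case: (cl (1 - t) (t * e) m); rewrite -?pt ?subr_gt0 ?mulr_gt0.
  case: y'z'; apply: (full (m / e)) => //; first by rewrite divr_ge0 // ltW.
  move: pt; rewrite t1 subrr scale0r add0r mul1r pm => me.
  by rewrite mulrC -scalerA me scalerA mulVf ?scale1r // gt_eqF.
- by case: (xsL p xsp); right.
- case/segspy: spyp => t [t0 t1 pt]; case/segxr: xrp => m [m0 m1 pm].
  have /eqP := congr1 (cross a) pt; rewrite pm !crossZr crossvv mulr0 eq_sym mulf_eq0.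
  by case/orP => /eqP // t00; move: t0; rewrite t00 leNgt e0.
- case/segspy: spyp => t [t0 t1 pt]; case/segrpz: rpzp => m [m0 m1 pm].
  have tp : 0 < t by lra.
  case: y'z'; apply: (full (m / t)) => //; first by rewrite divr_ge0 // ltW.
  by rewrite mulrC -scalerA -pm pt scalerA mulVf ?scale1r // gt_eqF.
- case/segspy: spyp => t [t0 t1 pt].
  have ppz : p = pz by apply: DZ => //; apply: in_disc pt => //; lra.
  by case: y'z'; apply/esym/(full t) => //; [lra|rewrite /z' -ppz].
- by case: (xrL p xrp); left.
- case/segrpz: rpzp => t [t0 t1 pt].
  have ppy : p = py by apply: DY => //; apply: in_disc pt.
  by case: y'z'; apply/(full t) => //; rewrite /y' -ppy.
- by case: (YZ p).
Qed.
End Contraction.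

(** * Contracting an edge at a vertex of degree three *)

Section Access.
Variable R : realType.
Implicit Types (p q r c u v w x y z a d : R * R) (A B K L C X Y Z P Q : set (R * R)).

(** What allows [X] to be doubled near [x]: segments from [x] in directions close to
    the initial direction [d] of [X] are free of [K] up to a common length. *)
Definition access K X x := exists d,
  (forall t : R, 0 <= t <= 1 -> X (x + t *: d)) /\
  \forall u \near d, forall t : R, 0 < t -> t <= 1 -> ~ K (x + t *: u).

Lemma cone_scale K x d (s : R) : 0 < s -> s <= 1 ->
  (\forall u \near d, forall t : R, 0 < t -> t <= 1 -> ~ K (x + t *: u)) ->
  \forall u \near s *: d, forall t : R, 0 < t -> t <= 1 -> ~ K (x + t *: u).
Proof.
move=> s0 s1 cone.
have cs : continuous (fun u : R * R => s^-1 *: u).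
  by move=> u; apply: cvgZ; [exact: cvg_cst|exact: cvg_id].
have sd : s^-1 *: (s *: d) = d by rewrite scalerA mulVf ?scale1r // gt_eqF.
have cone' : nbhs (s^-1 *: (s *: d))
    [set u | forall t : R, 0 < t -> t <= 1 -> ~ K (x + t *: u)].
  by rewrite sd; exact: cone.
have /filterS : nbhs (s *: d)
    [set u | forall t : R, 0 < t -> t <= 1 -> ~ K (x + t *: (s^-1 *: u))].
  exact: (cs _ _ cone').
apply => u /= Hu t t0 t1.
have := Hu (t * s); rewrite mulr_gt0 // => /(_ isT).
rewrite mulr_ile1 ?(ltW t0) ?(ltW s0) // => /(_ isT).
by rewrite scalerA mulfK // gt_eqF.
Qed.

(** Accessibility depends only on what [K] and [X] are near [x]. *)
Lemma access_local K K' X X' L L' x : access K X x ->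
  K' `<=` K `|` L -> X `<=` X' `|` L' -> closed L -> ~ L x -> closed L' -> ~ L' x ->
  access K' X' x.
Proof.
case=> d [dX cone] KL XL cL nL cL' nL'.
have cLL : closed (L `|` L') by exact: closedU.
have nLL : ~ (L `|` L') x by case.
have nb : nbhs (x + 0 *: d) (~` (L `|` L')).
  by rewrite scale0r addr0; apply: open_nbhs_nbhs; split => //; exact: closed_openC.
have /nbhs_ballP[e /= e0 be] := @line_continuous R x d 0 _ nb.
pose s := Num.min (e / 2) 1.
have s0 : 0 < s by rewrite lt_min divr_gt0 //=.
have s1 : s <= 1 by rewrite ge_min lexx orbT.
have se : s <= e / 2 by rewrite ge_min lexx.
have av (t : R) : 0 <= t <= 1 -> ~ (L `|` L') (x + t *: (s *: d)).
  case/andP => t0 t1; rewrite scalerA; apply: be.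
  by rewrite /ball /= sub0r normrN ger0_norm; nra.
exists (s *: d); split.
  move=> t /[dup] t01 /av nl; case: (XL (x + t *: (s *: d))) => //.
    by rewrite scalerA; apply: dX; case/andP: t01 => t0 t1; apply/andP; split; nra.
  by move=> ?; case: nl; right.
have avL (t : R) : 0 <= t <= 1 -> ~ L (x + t *: (s *: d)).
  by move=> t01 Lx; case: (av t t01); left.
apply: (filterS _ (filterI (cone_scale s0 s1 cone) (tube_avoid cL avL))).
move=> u [h1 h2] t t0 t1 /KL [|]; first exact: h1.
by apply: h2; rewrite ltW.
Qed.

(** Contracting the edge [wx] when the other edges at [w] go to [y] and [z]: the two
    new arcs leave [x] next to each other where [X] did. Instead of following [X]
    by two parallel curves, the branch point is brought to [x]: [w] is dragged to
    the straight end of [X], which takes [Y] and [Z] along. These may now cross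
    the segment from [x] to the new position [q] of [w], but up to its first point
    [r] on them that segment is clear, and [r] serves as branch point. *)
Lemma contract K x y z w X Y Z : closed K -> K x -> K y -> K z -> ~ K w ->
  is_arc w x X -> is_arc w y Y -> is_arc w z Z ->
  (forall p, X p -> K p -> p = x) -> (forall p, Y p -> K p -> p = y) ->
  (forall p, Z p -> K p -> p = z) -> (forall p, Y p -> Z p -> p = w) ->
  access K X x -> x <> y -> x <> z ->
  exists P Q, [/\ is_arc x y P, is_arc x z Q,
    forall p, P p -> K p -> p = x \/ p = y,
    forall p, Q p -> K p -> p = x \/ p = z &
    forall p, P p -> Q p -> p = x].
Proof.
move=> cK Kx Ky Kz nKw aX aY aZ XK YK ZK YZ [d [dX cone]] xy xz.
pose q := x + d.
have Xq : X q by have := dX 1; rewrite ler01 lexx scale1r; apply.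
have nKq : ~ K q.
  by have := nbhs_singleton cone; move=> /(_ 1 ltr01 (lexx _)); rewrite scale1r.
(* the part of [X] up to [q] is a connected set off [K] containing [w] and [q] *)
have [f [cf fi fK fw]] : exists f : R * R -> R * R,
    [/\ continuous f, injective f, forall x, K x -> f x = x & f w = q].
  case: (pselect (q = w)) => [->|qw].
    by exists id; split => // ?; exact: cvg_id.
  have qx : q <> x by move=> h; apply: nKq; rewrite h.
  have [B [C [aB aC XBC BC]]] := is_arc_split aX Xq qw qx.
  apply: (@drag _ K B) => //.
  - exact: is_arc_connected aB.
  - rewrite -subset0 => p [Bp Kp]; apply: qx.
    have px : p = x by apply: XK => //; rewrite XBC; left.
    by apply/esym/BC; split; [rewrite -px|exact: is_arc_target aC].
  - exact: is_arc_source aB.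
  - exact: is_arc_target aB.
have fAK A p0 : (forall p, A p -> K p -> p = p0) -> forall p, (f @` A) p -> K p -> p = p0.
  move=> AK _ [p Ap <-] /[dup] Kf /fK /fi fp; rewrite fp.
  by apply: AK; rewrite // -fp.
have aY' := is_arc_image cf fi aY; have aZ' := is_arc_image cf fi aZ.
rewrite fw fK // in aY'; rewrite fw fK // in aZ'.
have YK' := fAK _ _ YK; have ZK' := fAK _ _ ZK.
have YZ' p : (f @` Y) p -> (f @` Z) p -> p = q.
  by move=> [p1 Yp1 <-] [p2 Zp2] /fi e; rewrite -fw (YZ p1) // -e.
move: (f @` Y) (f @` Z) aY' aZ' YK' ZK' YZ' => {aY aZ YK ZK YZ fAK}Y' {}Z' aY aZ YK ZK YZ.
pose BC := Y' `|` Z'.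
have aBC : is_arc y z BC.
  by apply: is_arc_cat (is_arc_rev aY) aZ _ => p [/YZ h /h].
have cBC := is_arc_closed aBC.
have nBCx : ~ BC (x + 0 *: d).
  by rewrite scale0r addr0; case=> [/YK/(_ Kx)|/ZK/(_ Kx)].
have BCq : BC (x + 1 *: d) by rewrite scale1r; left; exact: is_arc_source aY.
have [s [s0 s1 BCr smin]] := first_hit_time (@line_continuous R x d) cBC nBCx BCq.
pose r := x + s *: d; rewrite -/r in BCr.
have nKr : ~ K r by apply: (nbhs_singleton cone).
have ry : r <> y by move=> h; apply: nKr; rewrite h.
have rz : r <> z by move=> h; apply: nKr; rewrite h.
have [Y1 [Z1 [aY1 aZ1 BCE Y1Z1]]] := is_arc_split aBC BCr ry rz.
have nZy : ~ Z1 y.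
  by move=> Zy; apply: ry; apply/esym/Y1Z1; split => //; exact: is_arc_source aY1.
have nYz : ~ Y1 z.
  by move=> Yz; apply: rz; apply/esym/Y1Z1; split => //; exact: is_arc_target aZ1.
have BCK p : BC p -> K p -> p = y \/ p = z.
  by case=> [Yp Kp|Zp Kp]; [left; exact: YK|right; exact: ZK].
have YK1 p : Y1 p -> K p -> p = y.
  move=> Yp Kp; have : BC p by rewrite BCE; left.
  by case/BCK => // pz; case: nYz; rewrite -pz.
have ZK1 p : Z1 p -> K p -> p = z.
  move=> Yp Kp; have : BC p by rewrite BCE; right.
  by case/BCK => // pz; case: nZy; rewrite -pz.
have [c c0 DK] := disc_avoid cK nKr.
have far p : K p -> c < sqn (p - r).
  by move=> Kp; rewrite ltNge; apply/negP => /DK.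
have sqrr : sqn (r - r) <= c by rewrite subrr sqn0 ltW.
have [py [Y2 [_ [aY2 Y2Y pyc DY _]]]] :=
  is_arc_first_level (@sqn_continuous R r) aY1 (far _ Ky) sqrr.
have [pz [Z2 [_ [aZ2 Z2Z pzc DZ _]]]] :=
  is_arc_first_level (@sqn_continuous R r) (is_arc_rev aZ1) (far _ Kz) sqrr.
have pr0 p : sqn (p - r) = c -> p <> r.
  move=> pc pr; move: c0; rewrite -pc pr subrr.
  by rewrite sqn0 ltxx.
have rx : r - x = s *: d by rewrite /r addrC addKr.
have cone' : \forall u \near r - x, forall t : R, 0 < t -> t <= 1 -> ~ K (x + t *: u).
  by rewrite rx; exact: cone_scale.
have Y2Z2 p : Y2 p -> Z2 p -> False.
  move=> /[dup] Yp /Y2Y Y1p /[dup] Zp /Z2Z Z1p.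
  have pr : p = r by apply: Y1Z1.
  have ppy : p = py by apply: DY; rewrite // pr.
  by apply: (pr0 _ pyc); rewrite -ppy.
have on_seg (t : R) : 0 <= t -> t < 1 -> ~ BC (x + t *: (r - x)).
  by move=> t0 t1; rewrite rx scalerA; apply: smin; nra.
have offr p : Y2 p \/ Z2 p -> p <> r.
  case=> h pr.
    have : p = py by apply: DY; rewrite // pr.
    by rewrite pr => /esym; exact: pr0.
  have : p = pz by apply: DZ; rewrite // pr.
  by rewrite pr => /esym; exact: pr0.
have sub2 p : Y2 p \/ Z2 p -> BC p.
  by rewrite BCE; case=> [/Y2Y|/Z2Z]; [left|right].
have on_seg1 (t : R) : 0 <= t <= 1 -> ~ (Y2 `|` Z2) (x + t *: (r - x)).
  case/andP => t0 t1 h; case: (ltgtP t 1) t1 => // [t1 _|t1 _].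
    by apply: (on_seg t) => //; exact: sub2.
  by apply: (offr _ h); rewrite t1 scale1r addrC subrK.
(* The segment from [x] to [r] meets the arms only in [r], so it does not enter
   the disc along one of their radii. *)
have npos p : Y2 p \/ Z2 p -> sqn (p - r) = c ->
    forall k : R, 0 < k -> x - r <> k *: (p - r).
  move=> YZp pc k k0 e; have := far _ Kx; rewrite e sqnZ pc ltr_pMl // expr_gt1 ?ltW // => k1.
  apply: (on_seg (1 - k^-1)).
  - by rewrite subr_ge0 invf_le1 // ltW.
  - by rewrite gtrBl invr_gt0.
  - have -> : x + (1 - k^-1) *: (r - x) = r + k^-1 *: (x - r).
      by apply: pairE; rewrite !vecE; ring.
    rewrite e scalerA mulVf ?scale1r; last by rewrite gt_eqF.
    by rewrite addrC subrK; exact: sub2.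
have Ypy : Y2 py by exact: is_arc_target aY2.
have Zpz : Z2 pz by exact: is_arc_target aZ2.
have xr0 : x - r <> 0 by move/eqP; rewrite subr_eq0 => /eqP h; apply: nKr; rewrite -h.
have yzc : sqn (py - r) = sqn (pz - r) by rewrite pyc.
have yc0 : 0 < sqn (py - r) by rewrite pyc.
have pyz : py - r <> pz - r by move=> /addIr e; apply: (Y2Z2 py) => //; rewrite e.
have posy := npos py (or_introl Ypy) pyc; have posz := npos pz (or_intror Zpz) pzc.
have YK2 p : Y2 p -> K p -> p = y by move/Y2Y; exact: YK1.
have ZK2 p : Z2 p -> K p -> p = z by move/Z2Z; exact: ZK1.
have [cl|cl] := clear_turn_total xr0 yzc yc0 pyz posy posz.
  exact: (contract_clear Kx cone' c0 DK aY2 aZ2 YK2 ZK2 Y2Z2 pyc DY pzc DZ on_seg1 posz cl).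
have Z2Y2 p : Z2 p -> Y2 p -> False by move=> Zp Yp; exact: Y2Z2 Zp.
rewrite setUC in on_seg1.
have [P [Q [aP aQ PK QK PQ]]] :=
  contract_clear Kx cone' c0 DK aZ2 aY2 ZK2 YK2 Z2Y2 pzc DZ pyc DY on_seg1 posy cl.
by exists Q, P; split => // p Qp Pp; exact: PQ.
Qed.
End Access.

(** * From a star to a triangle *)

Section Triangle.
Variable R : realType.
Implicit Types (p q r s u v w x y z a b d : R * R) (A B K L X Y Z P Q : set (R * R)).

Lemma chord_in_disc p q r (c : R) : sqn (p - r) = c -> sqn (q - r) = c ->
  forall m, seg p q m -> sqn (m - r) <= c.
Proof.
move=> pc qc m; rewrite segE => -[t [t0 t1 ->]].
have -> : sqn (p + t *: (q - p) - r) =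
    (1 - t) * sqn (p - r) + t * sqn (q - r) - t * (1 - t) * sqn (q - p).
  by rewrite /sqn !vecE; ring.
have : 0 <= t * (1 - t) * sqn (q - p) by rewrite !mulr_ge0 ?sqn_ge0 ?subr_ge0.
by rewrite pc qc; lra.
Qed.

Lemma chord_on_circle p q r (c : R) : p <> q -> sqn (p - r) = c -> sqn (q - r) = c ->
  forall m, seg p q m -> sqn (m - r) = c -> m = p \/ m = q.
Proof.
move=> pq pc qc m; rewrite segE => -[t [t0 t1 ->]].
have -> : sqn (p + t *: (q - p) - r) =
    (1 - t) * sqn (p - r) + t * sqn (q - r) - t * (1 - t) * sqn (q - p).
  by rewrite /sqn !vecE; ring.
rewrite pc qc => h; have : t * (1 - t) * sqn (q - p) = 0 by lra.
have qp0 : sqn (q - p) != 0.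
  by apply/eqP => /sqn_eq0/eqP; rewrite subr_eq0 => /eqP /esym.
move/eqP; rewrite !mulf_eq0 (negbTE qp0) orbF subr_eq0 => /orP[/eqP ->|/eqP <-].
  by left; rewrite scale0r addr0.
by right; rewrite scale1r addrC subrK.
Qed.

Lemma chords_meet p q s r (c : R) : p <> q -> p <> s -> q <> s ->
  sqn (p - r) = c -> sqn (q - r) = c -> sqn (s - r) = c ->
  forall m, seg p q m -> seg p s m -> m = p.
Proof.
move=> pq ps qs pc qc sc m; rewrite !segE => -[t [t0 t1 ->]] [t' [t0' t1']].
have [->|tn0] := eqVneq t 0; first by rewrite scale0r addr0.
move=> /addrI e; have [k uw] : exists k : R, q - p = k *: (s - p).
  by exists (t' / t); rewrite mulrC -scalerA -e scalerA mulVf ?scale1r.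
pose D := 2 * ((p.1 - r.1) * (s.1 - p.1) + (p.2 - r.2) * (s.2 - p.2)).
have hs : D + sqn (s - p) = 0.
  have -> : D + sqn (s - p) = sqn (s - r) - sqn (p - r) by rewrite /D /sqn !vecE; ring.
  by rewrite sc pc subrr.
have hq : k * D + k ^+ 2 * sqn (s - p) = 0.
  have -> : k * D + k ^+ 2 * sqn (s - p) = sqn (p + k *: (s - p) - r) - sqn (p - r).
    by rewrite /D /sqn !vecE; ring.
  by rewrite -uw (addrC p) subrK qc pc subrr.
have sp0 : sqn (s - p) != 0.
  by apply/eqP => /sqn_eq0/eqP; rewrite subr_eq0 => /eqP /esym.
have : k * (k - 1) * sqn (s - p) = 0.
  have -> : k * (k - 1) * sqn (s - p) =
            k * D + k ^+ 2 * sqn (s - p) - k * (D + sqn (s - p)) by ring.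
  by rewrite hq hs mulr0 subrr.
move/eqP; rewrite !mulf_eq0 (negbTE sp0) orbF subr_eq0 => /orP[] /eqP k0; move: uw.
  by rewrite k0 scale0r => /eqP; rewrite subr_eq0 => /eqP /esym.
by rewrite k0 scale1r => /addIr.
Qed.

(** Truncation of the star at [v]: its arms, cut off at a small circle around [v],
    end in [pa], [pb] and [pc], and the chords between these points complete a
    triangle with three arms. Contracting the arms one after the other carries
    the corners of the triangle to [a], [b] and [c]. At each contraction the
    fixed set consists of [K] together with the remaining arms and those sides
    that are not at the moving corner. *)
Lemma star_triangle K v a b c A B C : closed K -> ~ K v -> K a -> K b -> K c ->
  a <> b -> a <> c -> b <> c ->
  is_arc a v A -> is_arc b v B -> is_arc c v C ->
  (forall p, A p -> K p -> p = a) -> (forall p, B p -> K p -> p = b) ->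
  (forall p, C p -> K p -> p = c) ->
  (forall p, A p -> B p -> p = v) -> (forall p, A p -> C p -> p = v) ->
  (forall p, B p -> C p -> p = v) ->
  access K A a -> access K B b -> access K C c ->
  exists AB AC BC, [/\ is_arc a b AB, is_arc a c AC & is_arc b c BC] /\
   [/\ forall p, AB p -> K p -> p = a \/ p = b,
       forall p, AC p -> K p -> p = a \/ p = c,
       forall p, BC p -> K p -> p = b \/ p = c &
     [/\ forall p, AB p -> AC p -> p = a, forall p, AB p -> BC p -> p = b &
         forall p, AC p -> BC p -> p = c]].
Proof.
move=> cK nKv Ka Kb Kc ab ac bc aA aB aC AK BK CK AB AC BC accA accB accC.
have [e e0 DK] := disc_avoid cK nKv.
have far p : K p -> e < sqn (p - v) by move=> Kp; rewrite ltNge; apply/negP => /DK.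
have vv : sqn (v - v) <= e by rewrite subrr sqn0 ltW.
have [pa [A' [LA [aA' A'A pae DA [cLA nLA ALA]]]]] :=
  is_arc_first_level (@sqn_continuous R v) aA (far _ Ka) vv.
have [pb [B' [LB [aB' B'B pbe DB [cLB nLB BLB]]]]] :=
  is_arc_first_level (@sqn_continuous R v) aB (far _ Kb) vv.
have [pc [C' [LC [aC' C'C pce DC [cLC nLC CLC]]]]] :=
  is_arc_first_level (@sqn_continuous R v) aC (far _ Kc) vv.
have circ p : sqn (p - v) = e -> p <> v.
  move=> pe pv; move: e0; rewrite -pe pv subrr.
  by rewrite sqn0 ltxx.
have A'B' p : A' p -> B' p -> False.
  move=> A'p B'p; have pv := AB p (A'A _ A'p) (B'B _ B'p).
  by apply: (circ _ pae); rewrite -(DA p) // pv.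
have A'C' p : A' p -> C' p -> False.
  move=> A'p C'p; have pv := AC p (A'A _ A'p) (C'C _ C'p).
  by apply: (circ _ pae); rewrite -(DA p) // pv.
have B'C' p : B' p -> C' p -> False.
  move=> B'p C'p; have pv := BC p (B'B _ B'p) (C'C _ C'p).
  by apply: (circ _ pbe); rewrite -(DB p) // pv.
have A'a := is_arc_source aA'; have A'pa := is_arc_target aA'.
have B'b := is_arc_source aB'; have B'pb := is_arc_target aB'.
have C'c := is_arc_source aC'; have C'pc := is_arc_target aC'.
have pab : pa <> pb by move=> h; apply: (A'B' pa) => //; rewrite h.
have pac : pa <> pc by move=> h; apply: (A'C' pa) => //; rewrite h.
have pbc : pb <> pc by move=> h; apply: (B'C' pb) => //; rewrite h.
have A'K p : A' p -> K p -> p = a by move/A'A; exact: AK.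
have B'K p : B' p -> K p -> p = b by move/B'B; exact: BK.
have C'K p : C' p -> K p -> p = c by move/C'C; exact: CK.
have chD x y p : sqn (x - v) = e -> sqn (y - v) = e -> seg x y p -> sqn (p - v) <= e.
  by move=> xe ye; exact: chord_in_disc.
have chK x y p : sqn (x - v) = e -> sqn (y - v) = e -> seg x y p -> K p -> False.
  by move=> xe ye /(chD _ _ _ xe ye) /DK.
have ch1 p q m : p <> q -> sqn (p - v) = e -> sqn (q - v) = e -> seg p q m ->
    sqn (m - v) = e -> m = p \/ m = q.
  by move=> pq pe qe; exact: chord_on_circle.
have cA' := is_arc_closed aA'; have cB' := is_arc_closed aB'.
have cC' := is_arc_closed aC'.
have abc := is_arc_seg pbc.
have nseg_a : ~ seg pb pc pa.
  by move=> /(ch1 _ _ _ pbc pbe pce) /(_ pae) [].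
have [P [Q [aP aQ PK1 QK1 PQ]]] : exists P Q, [/\ is_arc a pb P, is_arc a pc Q,
    forall p, P p -> [\/ K p, B' p, C' p | seg pb pc p] -> p = a \/ p = pb,
    forall p, Q p -> [\/ K p, B' p, C' p | seg pb pc p] -> p = a \/ p = pc &
    forall p, P p -> Q p -> p = a].
  pose K1 := [set p | [\/ K p, B' p, C' p | seg pb pc p]].
  have K1E : K1 = K `|` (B' `|` (C' `|` seg pb pc)).
    apply/seteqP; split=> p.
      by case=> h; [left|right; left|right; right; left|do 3 right].
    by case=> [|[|[|]]] h; [apply: Or41|apply: Or42|apply: Or43|apply: Or44].
  have cS : closed (B' `|` (C' `|` seg pb pc)).
    by apply: closedU => //; apply: closedU => //; exact: is_arc_closed abc.
  apply: (@contract R K1 a pb pc pa A' (seg pa pb) (seg pa pc)) => //.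
  - by rewrite K1E; exact: closedU.
  - exact: Or41.
  - exact: Or42.
  - exact: Or43.
  - case=> [Kpa|B'pa|C'pa|//]; [|exact: (A'B' pa)|exact: (A'C' pa)].
    by apply: (DK pa); rewrite // pae.
  - exact: is_arc_rev.
  - exact: is_arc_seg.
  - exact: is_arc_seg.
  - move=> p A'p [/A'K|/A'B'|/A'C'|pbcp]; [exact|by move/(_ A'p)|by move/(_ A'p)|].
    have pe := chD _ _ _ pbe pce pbcp.
    by case: nseg_a; rewrite -(DA p).
  - move=> p sp [Kp|B'p|C'p|pbcp].
    + by case: (chK _ _ _ pae pbe sp).
    + by apply: DB => //; exact: (chD _ _ _ pae pbe sp).
    + have ppc : p = pc by apply: DC => //; exact: (chD _ _ _ pae pbe sp).
      by case: (ch1 _ _ _ pab pae pbe sp); rewrite ppc // => /esym.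
    + by rewrite segC in sp; apply: (chords_meet _ _ _ pbe pae pce sp pbcp) => // /esym.
  - move=> p sp [Kp|B'p|C'p|pbcp].
    + by case: (chK _ _ _ pae pce sp).
    + have ppb : p = pb by apply: DB => //; exact: (chD _ _ _ pae pce sp).
      by case: (ch1 _ _ _ pac pae pce sp); rewrite ppb // => /esym.
    + by apply: DC => //; exact: (chD _ _ _ pae pce sp).
    + rewrite segC in sp; rewrite segC in pbcp.
      by apply: (chords_meet _ _ _ pce pae pbe sp pbcp) => // /esym.
  - by move=> p; exact: (chords_meet pab pac pbc pae pbe pce).
  - apply: (access_local accA) ALA cS _ cLA nLA; first by rewrite K1E.
    by case=> [/A'B'|[/A'C'|/chK h]]; [exact|exact|exact: (h pbe pce)].
  - by move=> h; rewrite h in Ka; apply: (DK pb) => //; rewrite pbe.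
  - by move=> h; rewrite h in Ka; apply: (DK pc) => //; rewrite pce.
have Dn x : sqn (x - v) = e -> K x -> False by move=> xe; apply: DK; rewrite xe.
have cP := is_arc_closed aP; have cQ := is_arc_closed aQ.
have Pa := is_arc_source aP; have Ppb := is_arc_target aP.
have Qa := is_arc_source aQ; have Qpc := is_arc_target aQ.
have nQpb : ~ Q pb.
  by move=> /QK1 [|h|]; [exact: Or42|apply: (Dn pb) => //; rewrite h|].
have nQb : ~ Q b.
  move=> /QK1 [|/esym|h]; [exact: Or41|exact: ab|by apply: (Dn pc) => //; rewrite -h].
have nPc : ~ P c.
  move=> /PK1 [|/esym|h]; [exact: Or41|exact: ac|by apply: (Dn pb) => //; rewrite -h].
have nB'a : ~ B' a by move=> /A'B'; exact.
have nC'a : ~ C' a by move=> /A'C'; exact.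
have nC'b : ~ C' b by move=> /(B'C' b); exact.
have nB'pc : ~ B' pc by move=> /B'C'; exact.
have nC'pb : ~ C' pb by move=> /(B'C' pb); exact.
have [S [T [aS aT SK2 TK2 ST]]] : exists S T, [/\ is_arc b a S, is_arc b pc T,
    forall p, S p -> [\/ K p, C' p | Q p] -> p = b \/ p = a,
    forall p, T p -> [\/ K p, C' p | Q p] -> p = b \/ p = pc &
    forall p, S p -> T p -> p = b].
  pose K2 := [set p | [\/ K p, C' p | Q p]].
  have K2E : K2 = K `|` (C' `|` Q).
    apply/seteqP; split=> p; first by case=> h; [left|right; left|right; right].
    by case=> [|[|]] h; [apply: Or31|apply: Or32|apply: Or33].
  have cS : closed (C' `|` Q) by exact: closedU.
  apply: (@contract R K2 b a pc pb B' P (seg pb pc)) => //.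
  - by rewrite K2E; exact: closedU.
  - exact: Or31.
  - exact: Or31.
  - exact: Or32.
  - by case=> // /(Dn pb); exact.
  - exact: is_arc_rev.
  - exact: is_arc_rev.
  - move=> p B'p [/B'K|/B'C'|Qp]; [exact|by move/(_ B'p)|].
    by case: (QK1 _ Qp (Or42 _ _ _ B'p)) => h; move: B'p; rewrite h.
  - move=> p Pp [Kp|C'p|Qp]; last exact: PQ.
      case: (PK1 _ Pp (Or41 _ _ _ Kp)) => // h; by case: (Dn p) => //; rewrite h.
    by case: (PK1 _ Pp (Or43 _ _ _ C'p)) => // h; move: C'p; rewrite h.
  - move=> p sp [Kp|C'p|Qp].
    + by case: (chK _ _ _ pbe pce sp).
    + by apply: DC => //; exact: (chD _ _ _ pbe pce sp).
    + case: (QK1 _ Qp (Or44 _ _ _ sp)) => // h.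
      by case: (chK _ _ _ pbe pce sp); rewrite h.
  - move=> p Pp sp; case: (PK1 _ Pp (Or44 _ _ _ sp)) => // h.
    by case: (chK _ _ _ pbe pce sp); rewrite h.
  - apply: (access_local accB) BLB cS _ cLB nLB; first by rewrite K2E.
    by case.
  - by move/esym.
  - by move=> h; apply: (Dn pc) => //; rewrite -h.
have cS := is_arc_closed aS.
have nSc : ~ S c by move=> /SK2 [|/esym|/esym]; [exact: Or31|exact: bc|exact: ac].
have nSpc : ~ S pc.
  by move=> /SK2 [|h|h]; [exact: Or32|apply: (Dn pc) => //; rewrite h..].
have [U [W [aU aW UK3 WK3 UW]]] : exists U W, [/\ is_arc c a U, is_arc c b W,
    forall p, U p -> (K `|` S) p -> p = c \/ p = a,
    forall p, W p -> (K `|` S) p -> p = c \/ p = b &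
    forall p, U p -> W p -> p = c].
  apply: (@contract R (K `|` S) c a b pc C' Q T) => //.
  - exact: closedU.
  - by left.
  - by left.
  - by left.
  - by case=> // /(Dn pc); exact.
  - exact: is_arc_rev.
  - exact: is_arc_rev.
  - exact: is_arc_rev.
  - move=> p C'p [/C'K|Sp]; first exact.
    by case: (SK2 _ Sp (Or32 _ _ C'p)) => h; move: C'p; rewrite h.
  - move=> p Qp [Kp|Sp].
      case: (QK1 _ Qp (Or41 _ _ _ Kp)) => // h; by case: (Dn p) => //; rewrite h.
    by case: (SK2 _ Sp (Or33 _ _ Qp)) => // h; move: Qp; rewrite h.
  - move=> p Tp [Kp|Sp]; last exact: ST.
    case: (TK2 _ Tp (Or31 _ _ Kp)) => // h; by case: (Dn p) => //; rewrite h.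
  - move=> p Qp Tp; case: (TK2 _ Tp (Or33 _ _ Qp)) => // h.
    by move: Qp; rewrite h.
  - exact: (access_local accC) CLC cS _ cLC nLC.
  - by move/esym.
  - by move/esym.
exists S, U, W; split.
  by split; [exact: is_arc_rev|exact: is_arc_rev|exact: is_arc_rev].
split.
- by move=> p Sp Kp; case: (SK2 p Sp (Or31 _ _ Kp)); [right|left].
- by move=> p Up Kp; case: (UK3 p Up (or_introl Kp)); [right|left].
- by move=> p Wp Kp; case: (WK3 p Wp (or_introl Kp)); [right|left].
split.
- by move=> p Sp Up; case: (UK3 p Up (or_intror Sp)) => // h; move: Sp; rewrite h.
- by move=> p Sp Wp; case: (WK3 p Wp (or_intror Sp)) => // h; move: Sp; rewrite h.
- exact: UW.
Qed.
End Triangle.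

(** * Drawings with straight ends *)

Section Straighten.
Variable R : realType.
Implicit Types (p q r : R * R) (A B K L : set (R * R)).

(** The number [c] is a squared radius. The tip [p1] of the radius is required to lie
    on the original arc [A], which keeps the radii of different edges apart. *)
Definition straight_at A A' p (c : R) := exists p1, [/\ A p1, sqn (p1 - p) = c &
  forall m, A' m /\ sqn (m - p) <= c <-> seg p p1 m].

Lemma radius_in_disc p p1 m (c : R) : sqn (p1 - p) = c -> seg p p1 m -> sqn (m - p) <= c.
Proof.
move=> pc; rewrite segE => -[t [t0 t1 ->]].
by rewrite addrC addKr sqnZ pc ler_piMl ?expr_le1 // -pc sqn_ge0.
Qed.

(** The middle part of [A] between its last visit to the disc at [p] and its next
    visit to the disc at [q] is kept, and the ends are replaced by radii. *)
Lemma straighten_arc A p q (c : R) : 0 < c -> is_arc p q A ->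
  (forall m, sqn (m - p) <= c -> sqn (m - q) <= c -> False) ->
  exists A', [/\ is_arc p q A',
    forall m, A' m -> [\/ A m, sqn (m - p) <= c | sqn (m - q) <= c],
    straight_at A A' p c & straight_at A A' q c].
Proof.
move=> c0 aA dis.
have pp : sqn (p - p) <= c by rewrite subrr sqn0 ltW.
have qq : sqn (q - q) <= c by rewrite subrr sqn0 ltW.
have farq m : sqn (m - q) <= c -> c < sqn (m - p).
  by move=> mq; rewrite ltNge; apply/negP => mp; exact: dis mp mq.
have farp m : sqn (m - p) <= c -> c < sqn (m - q).
  by move=> mp; rewrite ltNge; apply/negP => mq; exact: dis mp mq.
have [p1 [B [_ [aB BA p1c DB _]]]] :=
  is_arc_first_level (@sqn_continuous R p) (is_arc_rev aA) (farq _ qq) pp.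
have p1q : c < sqn (p1 - q) by apply: farp; rewrite p1c.
have [q1 [M [_ [aM MB q1c DM _]]]] :=
  is_arc_first_level (@sqn_continuous R q) (is_arc_rev aB) p1q qq.
have pp1 : p <> p1 by move=> h; rewrite -p1c -h subrr sqn0 ltxx in c0.
have qq1 : q1 <> q by move=> h; rewrite -q1c h subrr sqn0 ltxx in c0.
have Sp m : seg p p1 m -> sqn (m - p) <= c by exact: radius_in_disc.
have Sq m : seg q1 q m -> sqn (m - q) <= c by rewrite segC; exact: radius_in_disc.
have Mp m : M m -> sqn (m - p) <= c -> m = p1 by move/MB; exact: DB.
have p1S : seg p p1 p1 by exact: is_arc_target (is_arc_seg pp1).
have q1S : seg q1 q q1 by exact: is_arc_source (is_arc_seg qq1).
exists (seg p p1 `|` (M `|` seg q1 q)); split.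
- apply: is_arc_cat (is_arc_seg pp1) _ _.
    apply: is_arc_cat aM (is_arc_seg qq1) _.
    by move=> m [Mm /Sq]; exact: DM.
  move=> m [/Sp mp [Mm|/Sq /(dis _ mp)//]]; exact: Mp.
- move=> m [/Sp h|[Mm|/Sq h]]; [exact: Or32| |exact: Or33].
  by apply: Or31; apply: BA; exact: MB.
- exists p1; split => //; first by apply: BA; exact: is_arc_target aB.
  move=> m; split => [[[//|[Mm|/Sq mq]] mp]|h].
  + by rewrite (Mp m).
  + by case: (dis m).
  + by split; [left|exact: Sp].
- exists q1; split => //; first by apply: BA; apply: MB; exact: is_arc_target aM.
  move=> m; rewrite (segC q); split => [[[mp|[Mm|//]] mq]|h].
  + by case: (dis m); first exact: Sp.
  + by rewrite (DM m).
  + by split; [right; right|exact: Sq].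
Qed.

Lemma disc_disjoint p q (c : R) : 4 * c < sqn (p - q) ->
  forall m, sqn (m - p) <= c -> sqn (m - q) <= c -> False.
Proof.
move=> pq m mp mq.
have : sqn (p - q) <= 2 * sqn (m - p) + 2 * sqn (m - q).
  rewrite -subr_ge0.
  have -> : 2 * sqn (m - p) + 2 * sqn (m - q) - sqn (p - q) =
            sqn ((m - p) + (m - q)) by rewrite /sqn !vecE; ring.
  exact: sqn_ge0.
lra.
Qed.

Lemma small_discs (G : sgraph) (pos : G -> R * R) (arc : G -> G -> set (R * R)) :
  plane_drawing pos arc -> exists c : R, [/\ 0 < c,
    forall x y, x <> y -> forall m, sqn (m - pos x) <= c -> sqn (m - pos y) <= c -> False &
    forall x z w, adj z w -> x <> z -> x <> w ->
      forall m, arc z w m -> sqn (m - pos x) <= c -> False].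
Proof.
move=> [ip arcP vx _].
have near_small (P : R -> Prop) (c0 : R) : 0 < c0 ->
    (forall c, 0 < c -> c <= c0 -> P c) -> \forall c \near (0 : R)^'+, P c.
  move=> c00 Pc; near=> c; apply: Pc; first by near: c; exact: nbhs_right_gt.
  by near: c; exact: nbhs_right_le.
have n1 : \forall c \near (0 : R)^'+, forall xy : G * G, xy.1 <> xy.2 ->
    forall m, sqn (m - pos xy.1) <= c -> sqn (m - pos xy.2) <= c -> False.
  apply: filter_forall => -[x y] /=; have [->|/eqP xy] := eqVneq x y.
    by apply: (near_small _ 1).
  have s0 : 0 < sqn (pos x - pos y).
    by apply: sqn_gt0 => /eqP; rewrite subr_eq0 => /eqP /ip.
  apply: (near_small _ (sqn (pos x - pos y) / 8)) => [|c c0 cs _].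
    by rewrite divr_gt0.
  by apply: disc_disjoint; lra.
have n2 : \forall c \near (0 : R)^'+, forall xzw : G * (G * G), adj xzw.2.1 xzw.2.2 ->
    xzw.1 <> xzw.2.1 -> xzw.1 <> xzw.2.2 ->
    forall m, arc xzw.2.1 xzw.2.2 m -> sqn (m - pos xzw.1) <= c -> False.
  apply: filter_forall => -[x [z w]] /=.
  case: (pselect [/\ adj z w, x <> z & x <> w]) => [[zw xz xw]|nxzw]; last first.
    by apply: (near_small _ 1) => // c _ _ zw xz xw; case: nxzw.
  have nx : ~ arc z w (pos x).
    by move=> h; apply: (vx z w x zw); split => //; case=> /ip.
  have [c0 c00 av] := disc_avoid (is_arc_closed (proj2 (arcP _ _ zw))) nx.
  apply: (near_small _ c0) => // c _ cc0 _ _ _ m am mx.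
  by apply: (av m) => //; apply: le_trans cc0.
have : \forall c \near (0 : R)^'+, exists c : R, [/\ 0 < c,
    forall x y, x <> y -> forall m, sqn (m - pos x) <= c -> sqn (m - pos y) <= c -> False &
    forall x z w, adj z w -> x <> z -> x <> w ->
      forall m, arc z w m -> sqn (m - pos x) <= c -> False].
  near=> c; exists c; split.
  - by near: c; exact: nbhs_right_gt.
  - move=> x y; suff H : forall xy : G * G, xy.1 <> xy.2 ->
      forall m, sqn (m - pos xy.1) <= c -> sqn (m - pos xy.2) <= c -> False.
      exact: (H (x, y)).
    by near: c.
  - move=> x z w; suff H : forall xzw : G * (G * G), adj xzw.2.1 xzw.2.2 ->
      xzw.1 <> xzw.2.1 -> xzw.1 <> xzw.2.2 ->
      forall m, arc xzw.2.1 xzw.2.2 m -> sqn (m - pos xzw.1) <= c -> False.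
      exact: (H (x, (z, w))).
    by near: c.
by move/filter_ex => [].
Unshelve. all: by end_near. Qed.

Definition rest_of_drawing (G : sgraph) (pos : G -> R * R) (arc : G -> G -> set (R * R))
    (x y : G) : set (R * R) :=
  [set m | (exists z w, [/\ adj z w, [set x; y]%SET != [set z; w]%SET & arc z w m])
        \/ exists z, m = pos z].

Lemma radii_meet p p1 p2 (c : R) : 0 < c -> sqn (p1 - p) = c -> sqn (p2 - p) = c ->
  p1 <> p2 -> forall m, seg p p1 m -> seg p p2 m -> m = p.
Proof.
move=> c0 h1 h2 ne m; rewrite !segE => -[t [t0 t1 ->]] [s [s0 s1 /addrI e]].
have : t ^+ 2 * c = s ^+ 2 * c by rewrite -{1}h1 -h2 -!sqnZ e.
move/(mulIf (lt0r_neq0 c0))/eqP; rewrite eqrXn2 // => /eqP ts.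
have [->|t00] := eqVneq t 0; first by rewrite scale0r addr0.
case: ne; apply: (addIr (- p)).
by rewrite -[LHS]scale1r -[RHS]scale1r -(mulVf t00) -!scalerA e ts.
Qed.

(** The radii replacing two edges at the same vertex end in points of the original
    edges, hence are distinct, hence meet only in the vertex; off the discs the
    new arcs are parts of the old ones. At a vertex only finitely many radii
    come together, so each of them has a free cone. *)
Lemma straighten (G : sgraph) (pos : G -> R * R) (arc : G -> G -> set (R * R)) :
  plane_drawing pos arc -> exists arc', plane_drawing pos arc' /\
    forall x y : G, adj x y -> access (rest_of_drawing pos arc' x y) (arc' x y) (pos x).
Proof.
move=> dr; have [c [c0 dis avoid]] := small_discs dr.
case: dr => ip arcP vx ex.
pose spec (x y : G) : set (set (R * R)) := [set A' | [/\ is_arc (pos x) (pos y) A',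
    forall m, A' m -> [\/ arc x y m, sqn (m - pos x) <= c | sqn (m - pos y) <= c],
    straight_at (arc x y) A' (pos x) c & straight_at (arc x y) A' (pos y) c]].
have adj_neq (x y : G) : adj x y -> x <> y by move=> xy h; move: xy; rewrite h adj_irrefl.
have spec_sub x y : adj x y -> spec x y `<=` spec y x.
  move=> xy A' [h1 h2 h3 h4]; split; rewrite -?(proj1 (arcP _ _ xy)) //.
  - exact: is_arc_rev.
  - by move=> m /h2 []; [exact: Or31|exact: Or33|exact: Or32].
have spec_sym x y : adj x y -> spec x y = spec y x.
  by move=> xy; apply/seteqP; split; apply: spec_sub; rewrite // adj_sym.
(* choosing for the symmetric specification makes [arc'] symmetric *)
pose arc' x y := xget set0 (spec x y).
have arc'P x y : adj x y -> spec x y (arc' x y).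
  move=> xy; apply: xgetPex.
  exact: (straighten_arc c0 (proj2 (arcP _ _ xy)) (dis _ _ (adj_neq _ _ xy))).
have arc'C x y : adj x y -> arc' x y = arc' y x by move=> xy; rewrite /arc' spec_sym.
have in_disc u x y m : adj x y -> arc' x y m -> sqn (m - pos u) <= c -> u = x \/ u = y.
  move=> xy axy mu; case: (pselect (u = x)) => [|ux]; [by left|right].
  apply: contrapT => uy; case: (arc'P _ _ xy) => _ /(_ _ axy) [am|mx|my] _ _.
  - exact: (avoid _ _ _ xy ux uy m).
  - exact: (dis _ _ ux m).
  - exact: (dis _ _ uy m).
have radius u x y : adj x y -> u = x \/ u = y -> straight_at (arc x y) (arc' x y) (pos u) c.
  by move=> /arc'P [_ _ h1 h2] [->|->].
have tips u x y z w p1 : adj x y -> adj z w -> [set x; y]%SET != [set z; w]%SET ->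
    arc x y p1 -> arc z w p1 -> sqn (p1 - pos u) = c -> u = x \/ u = y -> False.
  move=> xy zw ne p1xy p1zw p1c uxy.
  have nu t : p1 = pos t -> (t = x \/ t = y) -> False.
    move=> pt txy; case: (pselect (u = t)) => [ut|ut].
      by move: c0; rewrite -p1c pt ut subrr sqn0 ltxx.
    by apply: (dis _ _ ut p1); rewrite ?p1c // pt subrr sqn0 ltW.
  have : (set0 : set (R * R)) p1; last by [].
  rewrite -(ex x y z w xy zw ne); split => //; split => //.
  by move=> -[h|h]; [apply: (nu x)|apply: (nu y)]; auto.
have meet x y z w m : adj x y -> adj z w -> [set x; y]%SET != [set z; w]%SET ->
    arc' x y m -> arc' z w m -> m = pos x \/ m = pos y.
  move=> xy zw ne mxy mzw.
  case: (pselect (exists u, sqn (m - pos u) <= c)) => [[u mu]|nu].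
    have uxy := in_disc _ _ _ _ xy mxy mu; have uzw := in_disc _ _ _ _ zw mzw mu.
    have [p1 [p1a p1c p1s]] := radius _ _ _ xy uxy.
    have [p2 [p2a p2c p2s]] := radius _ _ _ zw uzw.
    have p12 : p1 <> p2.
      by move=> h; apply: (tips u x y z w p1) => //; rewrite h.
    have -> : m = pos u by apply: (radii_meet c0 p1c p2c p12); [apply/p1s|apply/p2s].
    by case: uxy => ->; [left|right].
  have mxy' : arc x y m.
    by case: (arc'P _ _ xy) => _ /(_ _ mxy) [//|h|h] _ _; case: nu; eexists; exact: h.
  have mzw' : arc z w m.
    by case: (arc'P _ _ zw) => _ /(_ _ mzw) [//|h|h] _ _; case: nu; eexists; exact: h.
  apply: contrapT => nm; have : (set0 : set (R * R)) m; last by [].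
  by rewrite -(ex x y z w xy zw ne).
have notpos x y z : adj x y -> arc' x y (pos z) -> z = x \/ z = y.
  by move=> xy h; apply: (in_disc _ _ _ _ xy h); rewrite subrr sqn0 ltW.
exists arc'; split; [split => //|].
- by move=> x y xy; split; [exact: arc'C|case: (arc'P _ _ xy)].
- by move=> x y z xy [/(notpos _ _ _ xy) [->|->]]; apply; [left|right].
- move=> x y z w xy zw ne; rewrite -subset0 => m [[mxy nm] mzw]; apply: nm.
  exact: (meet x y z w).
move=> x y xy; have [p1 [p1a p1c p1s]] := radius x _ _ xy (or_introl (erefl x)).
(* Half of the radius, so that directions close to [d] keep their endpoints inside
   the disc. *)
pose h : R := 2^-1; have h0 : 0 < h by rewrite invr_gt0.
have h1 : h <= 1 by rewrite invf_le1 // ler1n.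
pose d : R * R := h *: (p1 - pos x).
exists d; split.
  move=> t /andP[t0 t1]; apply: (proj2 (p1s _) _).1; rewrite segE.
  exists (t * h); split; [nra|nra|by rewrite scalerA].
have sd : sqn d = c / 4 by rewrite sqnZ p1c /h; field.
have ray2 p2 : sqn (p2 - pos x) = c -> p1 <> p2 ->
    \forall u \near d, forall t : R, 0 < t -> ~ seg (pos x) p2 (pos x + t *: u).
  move=> p2c p12.
  have sd2 : sqn (h *: (p2 - pos x)) = c / 4 by rewrite sqnZ p2c /h; field.
  have dd : sqn d = sqn (h *: (p2 - pos x)) by rewrite sd sd2.
  have d0 : 0 < sqn d by rewrite sd divr_gt0.
  have dne : d <> h *: (p2 - pos x).
    move=> e; apply: p12; apply: (addIr (- pos x)).
    by move/(congr1 (fun u => h^-1 *: u)): e; rewrite !scalerA mulVf ?scale1r // gt_eqF.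
  apply: (filterS _ (ray_avoid dd d0 dne)) => u Hu t t0.
  rewrite segE => -[s [s0 s1 /addrI e]].
  apply: (Hu (s / t / h)); first by rewrite !divr_ge0 // ltW.
  rewrite scalerA divfK ?gt_eqF // mulrC -scalerA -e scalerA mulVf ?scale1r //.
  by rewrite gt_eqF.
have near_edges : \forall u \near d, forall z : G, adj x z -> z <> y ->
    forall t : R, 0 < t -> sqn (t *: u) <= c -> ~ arc' x z (pos x + t *: u).
  apply: (@filter_forall (R * R)%type G (fun z => [set u | adj x z -> z <> y ->
    forall t : R, 0 < t -> sqn (t *: u) <= c -> ~ arc' x z (pos x + t *: u)]) (nbhs d)).
  move=> z; case: (pselect (adj x z /\ z <> y)) => [[xz zy]|nz]; last first.
    by apply: filterE => u xz zy; case: nz.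
  have [p2 [p2a p2c p2s]] := radius x _ _ xz (or_introl (erefl x)).
  have ne : [set x; y]%SET != [set x; z]%SET.
    apply/eqP => e; have : z \in [set x; y]%SET by rewrite e !inE eqxx orbT.
    rewrite !inE => /orP[/eqP zx|/eqP //]; by case: (adj_neq _ _ xz).
  have p12 : p1 <> p2.
    move=> e; apply: (tips x x y x z p1) => //; [by rewrite e|by left].
  apply: (filterS _ (ray2 _ p2c p12)) => u Hu _ _ t t0 tu axz.
  by apply: (Hu t t0); apply/p2s; split; rewrite // addrC addKr.
have near_size : \forall u \near d, 0 < sqn u /\ sqn u < c.
  have sc : continuous (fun u : R * R => sqn u).
    have := @sqn_continuous R 0; have -> // :
      (fun u => sqn (u - 0)) = (fun u : R * R => sqn u).
    by apply/funext => u; rewrite subr0.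
  have nb (S : set R) : open S -> S (c / 4) -> nbhs d [set u | S (sqn u)].
    move=> oS Sc; have nbS : nbhs (sqn d) S by rewrite sd; exact: open_nbhs_nbhs.
    exact: (sc _ _ nbS).
  have n1 := nb _ (@open_gt _ 0) (divr_gt0 c0 (ltr0n R 4)).
  have c4 : [set t : R | t < c] (c / 4) by rewrite /=; lra.
  have n2 := nb _ (@open_lt _ c) c4.
  exact: filterS (filterI n1 n2).
apply: (filterS _ (filterI near_edges near_size)) => u [Hu [u0 uc]] t t0 t1.
have tu : sqn (t *: u) <= c.
  by rewrite sqnZ; have : t ^+ 2 <= 1; [rewrite expr_le1 // ltW|nra].
have dx : sqn (pos x + t *: u - pos x) <= c by rewrite addrC addKr.
case=> [[z [w [zw ne az]]]|[z pz]]; last first.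
  case: (pselect (x = z)) => [xz|xz].
    move: pz; rewrite xz -[RHS]addr0 => /addrI /eqP.
    rewrite scaler_eq0 gt_eqF //= => /eqP u00; by rewrite u00 sqn0 ltxx in u0.
  by apply: (dis _ _ xz _ dx); rewrite pz subrr sqn0 ltW.
case: (in_disc _ _ _ _ zw az dx) => xz; subst.
  apply: (Hu w zw _ t) => // wy; by rewrite wy eqxx in ne.
rewrite arc'C // in az; rewrite adj_sym in zw.
by apply: (Hu z zw _ t) => // zy; rewrite zy finset.setUC eqxx in ne.
Qed.
End Straighten.

(** * Joining the neighbours of a vertex *)

Section Assembly.
Variable R : realType.
Implicit Types (p q r : R * R) (A B K L : set (R * R)).

Definition off_vertex (G : sgraph) (pos : G -> R * R)
    (arc : G -> G -> set (R * R)) (v : G) : set (R * R) :=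
  [set m | (exists z w, [/\ adj z w, z != v, w != v & arc z w m])
        \/ exists2 z, z != v & m = pos z].

Lemma off_vertex_closed (G : sgraph) (pos : G -> R * R)
    (arc : G -> G -> set (R * R)) (v : G) :
  (forall x y, adj x y -> closed (arc x y)) -> closed (off_vertex pos arc v).
Proof.
move=> cl.
have -> : off_vertex pos arc v =
    (\bigcup_(e in [set e : G * G | [&& adj e.1 e.2, e.1 != v & e.2 != v]]) arc e.1 e.2)
    `|` (\bigcup_(z in [set z | z != v]) [set pos z]).
  apply/seteqP; split=> m.
    case=> [[z [w [zw zv wv am]]]|[z zv ->]]; [left|right]; last by exists z.
    by exists (z, w) => //=; rewrite zw zv wv.
  case=> [[[z w] /= /and3P[zw zv wv] am]|[z zv ->]]; [left|right]; last by exists z.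
  by exists z, w.
apply: closedU; apply: closed_bigcup; try exact: finite_finset.
  by move=> [z w] /= /and3P[zw _ _]; exact: cl.
move=> z _; apply: compact_closed; [exact: norm_hausdorff|exact: compact_set1].
Qed.

(** With three neighbours this is the triangle drawn along the star at [v], with two
    neighbours the path through [v]; with fewer there is nothing to draw. *)
Lemma nbr_triangle (G : sgraph) (v : G) (pos : G -> R * R) (arc : G -> G -> set (R * R)) :
  plane_drawing pos arc ->
  (forall x y : G, adj x y -> access (rest_of_drawing pos arc x y) (arc x y) (pos x)) ->
  (#|neighbors v| <= 3)%N ->
  exists tri : G -> G -> set (R * R),
  [/\ forall x y, adj v x -> adj v y -> x != y ->
        tri x y = tri y x /\ is_arc (pos x) (pos y) (tri x y),
      forall x y p, adj v x -> adj v y -> x != y ->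
        tri x y p -> off_vertex pos arc v p -> p = pos x \/ p = pos y &
      forall x y z w p, adj v x -> adj v y -> x != y -> adj v z -> adj v w -> z != w ->
        [set x; y]%SET != [set z; w]%SET -> tri x y p -> tri z w p ->
        p = pos x \/ p = pos y].
Proof.
move=> [ip arcP vx ex] acc card3.
set K := off_vertex pos arc v.
have nvE (x : G) : adj v x = (x \in enum (neighbors v)) by rewrite mem_enum inE.
have meet x y z w m : adj x y -> adj z w -> [set x; y]%SET != [set z; w]%SET ->
    arc x y m -> arc z w m -> m = pos x \/ m = pos y.
  move=> xy zw ne mxy mzw; apply: contrapT => nm.
  have : (set0 : set (R * R)) m; last by [].
  by rewrite -(ex x y z w xy zw ne).
have onarc x y z : adj x y -> arc x y (pos z) -> z = x \/ z = y.
  move=> xy az; apply: contrapT => nz; apply: (vx x y z xy); split => //.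
  by case=> /ip; auto.
have ne_v x : adj v x -> x <> v by move=> vx' h; rewrite h adj_irrefl in vx'.
have armK x : adj v x -> forall p, arc x v p -> K p -> p = pos x.
  move=> /[dup] vx' /ne_v xv p; have xv' : adj x v by rewrite adj_sym.
  move=> axp [[z [w [zw zv wv azw]]]|[z zv pz]]; last first.
    rewrite pz; rewrite pz in axp; case: (onarc _ _ _ xv' axp) => [->//|h].
    by rewrite h eqxx in zv.
  have ne : [set x; v]%SET != [set z; w]%SET.
    apply/eqP => e; have : v \in [set z; w]%SET by rewrite -e !inE eqxx orbT.
    by rewrite !inE eq_sym (negbTE zv) eq_sym (negbTE wv).
  case: (meet _ _ _ _ _ xv' zw ne axp azw) => // pv.
  by rewrite pv in azw; case: (onarc _ _ _ zw azw) => h; rewrite h eqxx in zv wv.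
have armv x y : adj v x -> adj v y -> x <> y ->
    forall p, arc x v p -> arc y v p -> p = pos v.
  move=> vx' vy xy p ax ay; have xv : adj x v by rewrite adj_sym.
  have yv : adj y v by rewrite adj_sym.
  have ne : [set x; v]%SET != [set y; v]%SET.
    apply/eqP => e; have : x \in [set y; v]%SET by rewrite -e !inE eqxx.
    by rewrite !inE => /orP[]/eqP // h; case: (ne_v x).
  case: (meet _ _ _ _ _ xv yv ne ax ay) => // px; rewrite px in ay.
  by case: (onarc _ _ _ yv ay) => // h; case: (ne_v x).
have aarm x : adj v x -> is_arc (pos x) (pos v) (arc x v).
  by rewrite adj_sym => xv; case: (arcP _ _ xv).
have Kx x : adj v x -> K (pos x) by move=> /ne_v/eqP xv; right; exists x.
have accK x : adj v x -> access K (arc x v) (pos x).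
  rewrite adj_sym => xv; apply: (access_local (acc _ _ xv) (L := set0) (L' := set0)) => //.
  - move=> p Kp; left; case: Kp => [[z [w [zw zv wv azw]]]|[z zv pz]];
      [left|by right; exists z].
    exists z, w; split => //; apply/eqP => e.
    have : v \in [set z; w]%SET by rewrite -e !inE eqxx orbT.
    by rewrite !inE eq_sym (negbTE zv) eq_sym (negbTE wv).
  - exact: closed0.
  - exact: closed0.
have cK : closed K.
  by apply: off_vertex_closed => x y xy; exact: is_arc_closed (proj2 (arcP _ _ xy)).
have nKv : ~ K (pos v).
  case=> [[z [w [zw zv wv azw]]]|[z zv pz]].
    by case: (onarc _ _ _ zw azw) => h; rewrite h eqxx in zv wv.
  by rewrite (ip _ _ pz) eqxx in zv.
have posN x y : x <> y -> pos x <> pos y by move=> xy /ip.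
have: size (enum (neighbors v)) = #|neighbors v| by rewrite -cardE.
case: (enum (neighbors v)) (enum_uniq (neighbors v)) nvE => [|a [|b [|c [|d s]]]] un nvE sz.
- by exists (fun _ _ => set0); split => x y; rewrite nvE.
- exists (fun _ _ => set0).
  have no2 x y : adj v x -> adj v y -> x != y -> False.
    by rewrite !nvE !inE => /eqP-> /eqP->; rewrite eqxx.
  by split=> [x y vx' vy xy|x y p vx' vy xy|x y z w p vx' vy xy]; case: (no2 x y).
- have ab : a != b by move: un; rewrite /= !inE andbT.
  have va : adj v a by rewrite nvE !inE eqxx.
  have vb : adj v b by rewrite nvE !inE eqxx orbT.
  exists (fun _ _ => arc a v `|` arc b v).
  have aab : is_arc (pos a) (pos b) (arc a v `|` arc b v).
    apply: is_arc_cat (aarm _ va) (is_arc_rev (aarm _ vb)) _ => p [].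
    by apply: armv => //; exact/eqP.
  have two x y : adj v x -> adj v y -> x != y -> (x = a /\ y = b) \/ (x = b /\ y = a).
    rewrite !nvE !inE => /orP[]/eqP-> /orP[]/eqP->; rewrite ?eqxx // => _; [by left|by right].
  have abK p : (arc a v `|` arc b v) p -> K p -> p = pos a \/ p = pos b.
    by case=> [h /(armK _ va _ h)|h /(armK _ vb _ h)]; [left|right].
  split=> [x y vx' vy xy|x y p vx' vy xy ap Kp|x y z w p vx' vy xy vz vw zw].
  + by split=> //; case: (two x y vx' vy xy) => -[-> ->] //; exact: is_arc_rev.
  + by case: (two x y vx' vy xy) => -[-> ->]; case: (abK p ap Kp); auto.
  + by case: (two x y vx' vy xy) => -[-> ->]; case: (two z w vz vw zw) => -[-> ->];
      rewrite ?eqxx // finset.setUC eqxx.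
- move: un; rewrite /= !inE !negb_or andbT => /andP[/andP[ab ac] bc].
  have va : adj v a by rewrite nvE !inE eqxx.
  have vb : adj v b by rewrite nvE !inE eqxx orbT.
  have vc : adj v c by rewrite nvE !inE eqxx !orbT.
  have ab' := elimN eqP ab; have ac' := elimN eqP ac; have bc' := elimN eqP bc.
  have [AB [AC [BC [[aAB aAC aBC] [ABK ACK BCK [ABAC ABBC ACBC]]]]]] :=
    star_triangle cK nKv (Kx _ va) (Kx _ vb) (Kx _ vc)
      (posN _ _ ab') (posN _ _ ac') (posN _ _ bc') (aarm _ va) (aarm _ vb) (aarm _ vc)
      (armK _ va) (armK _ vb) (armK _ vc)
      (armv _ _ va vb ab') (armv _ _ va vc ac') (armv _ _ vb vc bc')
      (accK _ va) (accK _ vb) (accK _ vc).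
  pose tri (x y : G) := if (x != c) && (y != c) then AB
                        else if (x != b) && (y != b) then AC else BC.
  have ba : (b == a) = false by rewrite eq_sym (negbTE ab).
  have ca : (c == a) = false by rewrite eq_sym (negbTE ac).
  have cb : (c == b) = false by rewrite eq_sym (negbTE bc).
  have eqs := (negbTE ab, negbTE ac, negbTE bc, ba, ca, cb, eqxx).
  have triC x y : tri x y = tri y x by rewrite /tri ![(y != _) && _]andbC.
  have triE : [/\ tri a b = AB, tri a c = AC & tri b c = BC] by rewrite /tri !eqs.
  case: triE => tab tac tbc.
  have tba : tri b a = AB by rewrite triC.
  have tca : tri c a = AC by rewrite triC.
  have tcb : tri c b = BC by rewrite triC.
  (* a symmetric property of pairs of neighbours need only be checked on [ab], [ac], [bc] *)
  have wlog3 (P : G -> G -> Prop) :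
      (forall x y, P x y -> P y x) -> P a b -> P a c -> P b c ->
      forall x y, adj v x -> adj v y -> x != y -> P x y.
    move=> Psym Pab Pac Pbc x y.
    rewrite !nvE !inE => /or3P[]/eqP-> /or3P[]/eqP->; rewrite ?eqxx // => _; auto.
  exists tri; split.
  + apply: wlog3; rewrite ?tab ?tac ?tbc ?tba ?tca ?tcb; try by split.
    by move=> x y [xy axy]; rewrite -xy; split => //; exact: is_arc_rev.
  + move=> x y p vx' vy xy; move: p.
    apply: (wlog3 (fun x y => forall p, tri x y p -> K p -> p = pos x \/ p = pos y)) xy
      => //;
      rewrite ?tab ?tac ?tbc //.
    by move=> x1 y1 H p; rewrite triC => /H h /h [|]; auto.
  + move=> x y z w p vx' vy xy vz vw zw; move: z w vz vw zw.
    apply: (wlog3 (fun x y => forall z w, adj v z -> adj v w -> z != w ->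
      [set x; y]%SET != [set z; w]%SET -> tri x y p -> tri z w p ->
      p = pos x \/ p = pos y)) xy => //.
    * move=> x1 y1 H z w vz vw zw; rewrite triC finset.setUC => ne h1 h2.
      by case: (H z w vz vw zw ne h1 h2); auto.
    * apply: wlog3; rewrite ?tab ?tac ?tbc ?eqxx //.
      - by move=> z w; rewrite (triC z) (finset.setUC [set z]%SET).
      - by move=> _ h1 h2; left; exact: ABAC.
      - by move=> _ h1 h2; right; exact: ABBC.
    * apply: wlog3; rewrite ?tab ?tac ?tbc ?eqxx //.
      - by move=> z w; rewrite (triC z) (finset.setUC [set z]%SET).
      - by move=> _ h1 h2; left; exact: ABAC.
      - by move=> _ h1 h2; right; exact: ACBC.
    * apply: wlog3; rewrite ?tab ?tac ?tbc ?eqxx //.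
      - by move=> z w; rewrite (triC z) (finset.setUC [set z]%SET).
      - by move=> _ h1 h2; left; exact: ABBC.
      - by move=> _ h1 h2; right; exact: ACBC.
- by rewrite -sz in card3.
Qed.

(** [H] is any graph obtained by deleting [v], possibly further vertices and edges,
    and joining neighbours of [v] to each other. *)
Lemma planar_nbr_clique (G : sgraph) (v : G) (H : sgraph) (f : H -> G) :
  planar R G -> (#|neighbors v| <= 3)%N -> injective f -> (forall x, f x != v) ->
  (forall x y, adj x y -> adj (f x) (f y) \/ (adj v (f x) /\ adj v (f y))) ->
  planar R H.
Proof.
move=> [pos [arc0 dr0]] card3 fi fv fadj.
have [arc [dr acc]] := straighten dr0.
have [tri [triA triK triT]] := nbr_triangle dr acc card3.
case: dr => ip arcP vx ex.
have onarc x y z : adj x y -> arc x y (pos z) -> z = x \/ z = y.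
  move=> xy az; apply: contrapT => nz; apply: (vx x y z xy); split => //.
  by case=> /ip; auto.
pose arcH x y := if adj (f x) (f y) then arc (f x) (f y) else tri (f x) (f y).
have fneq (x y : H) : adj x y -> f x != f y.
  by move=> xy; apply/eqP => /fi h; rewrite h adj_irrefl in xy.
have arcH_cases x y : adj x y ->
    (adj (f x) (f y) /\ arcH x y = arc (f x) (f y)) \/
    [/\ adj v (f x), adj v (f y), f x != f y & arcH x y = tri (f x) (f y)].
  move=> xy; rewrite /arcH; case: ifP => fxy; [by left|right].
  by case: (fadj _ _ xy) => [|[h1 h2]]; [rewrite fxy|split => //; exact: fneq].
have off x y p : adj (f x) (f y) -> arc (f x) (f y) p -> off_vertex pos arc v p.
  by move=> xy ap; left; exists (f x), (f y).
have posoff x : off_vertex pos arc v (pos (f x)) by right; exists (f x).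
have set2_inj x y z w : [set x; y]%SET != [set z; w]%SET ->
    [set f x; f y]%SET != [set f z; f w]%SET.
  apply: contra => /eqP e; apply/eqP/setP => u.
  by have := congr1 (fun S : {set G} => f u \in S) e; rewrite !inE !(inj_eq fi).
exists (pos \o f), arcH; split.
- by move=> x y /ip /fi.
- move=> x y xy; rewrite /arcH (adj_sym (f y)); case: ifP => fxy; first exact: arcP.
  case: (fadj _ _ xy) => [|[vx' vy]]; first by rewrite fxy.
  exact: triA _ _ vx' vy (fneq _ _ xy).
- move=> x y z xy [az nz]; apply: nz.
  case: (arcH_cases _ _ xy) => [[fxy e]|[vx' vy xy' e]]; rewrite e in az.
    by case: (onarc _ _ _ fxy az) => h; [left|right]; rewrite /= h.
  by case: (triK _ _ _ vx' vy xy' az (posoff z)) => ->; [left|right].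
move=> x y z w xy zw /set2_inj ne; rewrite -subset0 => p [[axy nxy] azw]; apply: nxy.
case: (arcH_cases _ _ xy) => [[fxy e]|[vx' vy xy' e]]; rewrite e in axy;
  case: (arcH_cases _ _ zw) => [[fzw e']|[vz vw zw' e']]; rewrite e' in azw.
- apply: contrapT => nm; have : (set0 : set (R * R)) p; last by [].
  by rewrite -(ex _ _ _ _ fxy fzw ne).
- have := triK _ _ _ vz vw zw' azw (off _ _ _ fxy axy).
  by case=> pz; rewrite pz in axy; case: (onarc _ _ _ fxy axy) => h;
    rewrite pz h; [left|right|left|right].
- exact: triK (off _ _ _ fzw azw).
- by apply: triT vx' vy xy' vz vw zw' ne axy azw.
Qed.
End Assembly.

(** * The move *)

Theorem lemma4 (R : realType) (G : sgraph) (n : nat) (U : {set G})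
    (hU : (#|U| <= n)%N) (hplanar : planar R (del_vertices U))
    (v : G) (hv : v \notin U) (G' : sgraph) (hmove : Ydelta_move v G') :
  apex R n G'.
Proof.
case: hmove => a [b [c [card3 nbrE [f [[g fK gK] fadj]]]]].
pose U0 : {set del_vertices [set v]%SET} := [set x | val x \in U]%SET.
exists (f @: U0)%SET; split.
  apply: leq_trans hU; rewrite card_imset; last exact: can_inj fK.
  rewrite -(card_imset _ val_inj); apply/subset_leq_card/fintype.subsetP.
  by move=> _ /imsetP[x xU0 ->]; rewrite inE in xU0.
have offU (y : del_vertices (f @: U0)%SET) : val (g (val y)) \notin U.
  apply: contra (valP y) => gU; apply/imsetP; exists (g (val y)); last by rewrite gK.
  by rewrite inE.
pose psi (y : del_vertices (f @: U0)%SET) : del_vertices U := Sub (val (g (val y))) (offU y).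
pose v' : del_vertices U := Sub v hv.
apply: (@planar_nbr_clique R _ v' _ psi hplanar).
- rewrite -card3 -(card_imset _ val_inj); apply/subset_leq_card/fintype.subsetP.
  by move=> _ /imsetP[x xN ->]; rewrite !inE in xN *.
- move=> x y /(congr1 val); rewrite !SubK => /val_inj h; apply: val_inj.
  exact: (can_inj gK).
- move=> x; apply/eqP => /(congr1 val); rewrite !SubK => h.
  by have := valP (g (val x)); rewrite h inE eqxx.
move=> x y xy.
have {xy} : adj (f (g (val x))) (f (g (val y))) by rewrite !gK.
rewrite fadj => h.
have nv (u w1 w2 : del_vertices [set v]%SET) :
    u \in [set w1; w2]%SET -> val w1 \in neighbors v -> val w2 \in neighbors v -> adj v (val u).
  by rewrite !inE => /orP[]/eqP->.
have [na nb nc] : [/\ val a \in neighbors v, val b \in neighbors v & val c \in neighbors v].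
  by rewrite nbrE !inE !eqxx ?orbT.
move: h; rewrite /= /add_edge_adj => /orP[/orP[/orP[h|]|]|].
- by left.
- by case/and3P => _ h1 h2; right; split; [exact: nv h1 _ _|exact: nv h2 _ _].
- by case/and3P => _ h1 h2; right; split; [exact: nv h1 _ _|exact: nv h2 _ _].
- by case/and3P => _ h1 h2; right; split; [exact: nv h1 _ _|exact: nv h2 _ _].
Qed.
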